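(* The norm of the Hilbert matrix operator $\mathcal{H}$ acting from $H^\infty$ into the logarithmically weighted Hardy space $H^\infty_{\log}$ satisfies $$\|\mathcal{H}\|_{H^\infty\to H^\infty_{\log}}=1.$$
   Context: Let $\mathbb{D}$ be the open unit disk of $\mathbb{C}$ and $H(\mathbb{D})$ the set of all analytic functions in $\mathbb{D}$. For $f(z)=\sum_{k=0}^\infty a_kz^k\in H(\mathbb{D})$, the Hilbert matrix operator is defined by $$\mathcal{H}f(z)=\sum_{n=0}^\infty\left(\sum_{k=0}^\infty\frac{a_k}{n+k+1}\right)z^n,$$ whenever the right-hand side makes sense (the inner series converging as ordinary limits of partial sums) and defines an analytic function in $\mathbb{D}$. For $f\in H(\mathbb{D})$ and $0\le r<1$ put $M_\infty(r,f)=\sup_{0\le t<2\pi}|f(re^{it})|$. The space $H^\infty$ consists of all $f\in H(\mathbb{D})$ with $\|f\|_{H^\infty}=\sup_{0\le r<1}M_\infty(r,f)<\infty$. The logarithmically weighted Hardy space $H^\infty_{\log}$ consists of all $f\in H(\mathbb{D})$ with $$\|f\|_{H^\infty_{\log}}=\sup_{0\le r<1}\left(\log\frac{e}{(1-r)^2}\right)^{-1}M_\infty(r,f)<\infty.$$ The operator norm is $\|\mathcal{H}\|_{H^\infty\to H^\infty_{\log}}=\sup\{\|\mathcal{H}f\|_{H^\infty_{\log}}/\|f\|_{H^\infty}: 0\ne f\in H^\infty\}$. *)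

(* Defs.v *)
From Stdlib Require Import Reals.
From Coquelicot Require Import Coquelicot.

Local Open Scope R_scope.

Definition unit_disk (z : C) : Prop := Cmod z < 1.

(* Functions on the disk are total functions [C -> C]; their values outside the
   disk are never used. *)
Definition analytic (f : C -> C) : Prop :=
  forall z : C, unit_disk z -> @ex_derive C_AbsRing C_NormedModule f z.

Definition expansion (a : nat -> C) (f : C -> C) : Prop :=
  forall z : C, unit_disk z -> @is_pseries C_AbsRing C_NormedModule a z (f z).

(* Given as a relation because the operator is only partially defined.
   [b n] is the inner sum. *)
Definition hilbert_op (f g : C -> C) : Prop :=
  exists a b : nat -> C,
    expansion a f /\
    (forall n : nat,
       @is_series C_AbsRing C_NormedModule
         (fun k : nat => Cdiv (a k) (RtoC (INR (n + k + 1)))) (b n)) /\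
    expansion b g /\
    analytic g.

(* The pair is the complex number r e^{it}. *)
Definition M_infty (r : R) (f : C -> C) : Rbar :=
  Lub_Rbar (fun x : R => exists t : R,
    0 <= t < 2 * PI /\ x = Cmod (f (r * cos t, r * sin t))).

Definition norm_Hinf (f : C -> C) : Rbar :=
  Rbar_lub (fun x : Rbar => exists r : R, 0 <= r < 1 /\ x = M_infty r f).

Definition Hinf (f : C -> C) : Prop :=
  analytic f /\ Rbar_lt (norm_Hinf f) p_infty.

Definition norm_Hinf_log (f : C -> C) : Rbar :=
  Rbar_lub (fun x : Rbar => exists r : R, 0 <= r < 1 /\
    x = Rbar_mult (Finite (/ ln (exp 1 / (1 - r) ^ 2))) (M_infty r f)).

Definition Hinf_log (f : C -> C) : Prop :=
  analytic f /\ Rbar_lt (norm_Hinf_log f) p_infty.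

(* Nonzero in H(D): values outside the disk do not count. *)
Definition nonzero (f : C -> C) : Prop :=
  exists z : C, unit_disk z /\ f z <> RtoC 0.

Definition hilbert_norm : Rbar :=
  Rbar_lub (fun x : Rbar => exists f g : C -> C,
    Hinf f /\ nonzero f /\ hilbert_op f g /\
    x = Rbar_div (norm_Hinf_log g) (norm_Hinf f)).

(* Main.v *)
Require Import Defs.
From Stdlib Require Import Reals Lra Lia Classical IndefiniteDescription.
From Coquelicot Require Import Coquelicot.
Local Open Scope R_scope.

(** Write [L r = ln (e / (1 - r)^2) = 1 - 2 ln (1 - r)] for the weight. Since
    [1 / (n + k + 1)] is the integral of [t^(n+k)] over [0,1], the image [g] of
    [f] is formally the integral of [f t / (1 - t z)], so that [|f| <= M] gives
    [|g z| <= M * sum_n r^n / (n + 1)] with [r = |z|]. The term [n = 0] is [1]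
    and the others sum to at most [- ln (1 - r)], so [|g z| <= M * L r] and the
    norm is at most [1]. As [r] tends to [1] this bound is only about [M * L r / 2];
    the norm is attained at [r = 0], where [L 0 = 1]: for [f = 1] one has
    [g 0 = 1].

    Making this rigorous takes three steps.

    Existence of the Taylor coefficients. Analyticity is mere complex
    differentiability, so the Cauchy theory starts from Goursat's lemma
    ([goursat], by bisection). In the coordinate [log z] an annulus is a
    rectangle with two sides identified, whence means over circles do not
    depend on the radius ([circ_int_const]), even if the function is only
    continuous at one point ([goursat_except]). Applied to [f z / z^n] this
    defines the coefficients; applied to [z (f z - f z0) / (z - z0)], whose mean
    tends to [0] with the radius, it yields the expansion, because the
    partial sums telescope under the integral ([laurent_telescope],
    [taylor_expansion]).

    Convergence of the inner series. Parseval's identity for the partial sums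
    ([parseval_psum]) shows that the coefficients [a_k] of a bounded function
    are square-summable, hence [sum |a_k| / (k + 1)] is finite
    ([coeff_hardy_bound]). So all inner series converge, to bounded limits
    [b_n], and the power series with coefficients [b_n] is differentiable on
    the disk ([power_series_differentiable]).

    The bound. The integral estimate is carried out on polynomials
    ([hilbert_finite_sum_le]), namely on partial sums of [f (c t)] with
    [c < 1], and passed to the limit ([hilbert_psum_le]); summing the weights
    ([hilbert_weight_le]) gives the upper bound, and [hilbert_norm_attained]
    the lower one. *)

(** * The modulus of complex numbers *)

Lemma Cmod_le_sum (z : C) : Cmod z <= Rabs (Re z) + Rabs (Im z).
Proof.
  assert (H1 := Rabs_pos (Re z)). assert (H2 := Rabs_pos (Im z)).
  apply Rsqr_incr_0_var; [|lra].
  unfold Rsqr. replace (Cmod z * Cmod z) with (Cmod z ^ 2) by ring.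
  rewrite Cmod2_alt, <- (pow2_abs (Re z)), <- (pow2_abs (Im z)). nra.
Qed.

Lemma im_le_Cmod (z : C) : Rabs (Im z) <= Cmod z.
Proof. eapply Rle_trans; [apply Rmax_r|apply Rmax_Cmod]. Qed.

Lemma Cmod_triangle_rev (z w : C) : Cmod z - Cmod w <= Cmod (z - w)%C.
Proof.
  assert (H := Cmod_triangle (z - w)%C w).
  replace (z - w + w)%C with z in H by ring. lra.
Qed.

Lemma Cmod_minus_sym (z w : C) : Cmod (z - w)%C = Cmod (w - z)%C.
Proof. rewrite <- Cmod_opp. f_equal. ring. Qed.

Lemma Cmod_minus_triangle (z w : C) : Cmod (z - w)%C <= Cmod z + Cmod w.
Proof. unfold Cminus. rewrite <- (Cmod_opp w). apply Cmod_triangle. Qed.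

(** * Integrals of complex-valued functions of a real variable *)

(** Complex scalars act on such integrals, although the integral of functions
    with values in a normed space is linear over the reals only; working with
    real and imaginary parts makes this a computation ([is_CInt_scal]). *)
Definition is_CInt (f : R -> C) (a b : R) (l : C) : Prop :=
  is_RInt (fun t => Re (f t)) a b (Re l) /\ is_RInt (fun t => Im (f t)) a b (Im l).

Definition CInt (f : R -> C) (a b : R) : C :=
  (RInt (fun t => Re (f t)) a b, RInt (fun t => Im (f t)) a b).

Lemma is_CInt_unique f a b l : is_CInt f a b l -> CInt f a b = l.
Proof.
  intros [H1 H2]. unfold CInt.
  rewrite (is_RInt_unique _ _ _ _ H1), (is_RInt_unique _ _ _ _ H2). now destruct l.
Qed.

Lemma is_CInt_ext f g a b l :
  (forall t, Rmin a b < t < Rmax a b -> f t = g t) -> is_CInt f a b l -> is_CInt g a b l.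
Proof.
  intros E [H1 H2]. split; eapply is_RInt_ext; eauto; intros t Ht; simpl; now rewrite E.
Qed.

Lemma is_CInt_plus f g a b l m :
  is_CInt f a b l -> is_CInt g a b m -> is_CInt (fun t => f t + g t)%C a b (l + m)%C.
Proof.
  intros [H1 H2] [H3 H4].
  split; apply (@is_RInt_plus R_NormedModule); assumption.
Qed.

Lemma is_CInt_scal f a b l c :
  is_CInt f a b l -> is_CInt (fun t => c * f t)%C a b (c * l)%C.
Proof.
  intros [H1 H2]. split.
  - apply (@is_RInt_minus R_NormedModule); apply (@is_RInt_scal R_NormedModule); assumption.
  - apply (@is_RInt_plus R_NormedModule); apply (@is_RInt_scal R_NormedModule); assumption.
Qed.

Lemma is_CInt_minus f g a b l m :
  is_CInt f a b l -> is_CInt g a b m -> is_CInt (fun t => f t - g t)%C a b (l - m)%C.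
Proof.
  intros [H1 H2] [H3 H4].
  split; apply (@is_RInt_minus R_NormedModule); assumption.
Qed.

Lemma is_CInt_const c a b : is_CInt (fun _ => c) a b (RtoC (b - a) * c)%C.
Proof.
  split.
  - replace (Re (RtoC (b - a) * c)%C) with (scal (b - a) (Re c)).
    apply (@is_RInt_const R_NormedModule). rewrite re_scal_l. reflexivity.
  - replace (Im (RtoC (b - a) * c)%C) with (scal (b - a) (Im c)).
    apply (@is_RInt_const R_NormedModule). rewrite im_scal_l. reflexivity.
Qed.

Lemma is_CInt_Chasles f a b c l m :
  is_CInt f a b l -> is_CInt f b c m -> is_CInt f a c (l + m)%C.
Proof.
  intros [H1 H2] [H3 H4].
  split; eapply (@is_RInt_Chasles R_NormedModule); eassumption.
Qed.

Lemma is_CInt_swap f a b l : is_CInt f a b l -> is_CInt f b a (- l)%C.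
Proof.
  intros [H1 H2]. split; apply (@is_RInt_swap R_NormedModule); assumption.
Qed.

Lemma is_CInt_le f (g : R -> R) a b l m :
  a <= b -> (forall t, a <= t <= b -> Cmod (f t) <= g t) ->
  is_CInt f a b l -> is_RInt g a b m -> Cmod l <= m.
Proof.
  intros Hab Hg [H1 H2] Hm. rewrite Cmod_norm.
  apply (norm_RInt_le (V := C_R_NormedModule) f g a b l m Hab); auto.
  - intros t Ht. specialize (Hg t Ht). rewrite Cmod_norm in Hg. exact Hg.
  - destruct l as [l1 l2]. apply is_RInt_fct_extend_pair; assumption.
Qed.

Lemma is_CInt_le_const f a b l M :
  a <= b -> (forall t, a <= t <= b -> Cmod (f t) <= M) ->
  is_CInt f a b l -> Cmod l <= (b - a) * M.
Proof.
  intros Hab Hg Hl. refine (is_CInt_le f (fun _ => M) a b l _ Hab Hg Hl _).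
  apply (@is_RInt_const R_NormedModule).
Qed.

Definition cont_at (G : C -> C) (z : C) : Prop :=
  forall eps, 0 < eps -> exists delta, 0 < delta /\
    forall w, Cmod (w - z)%C < delta -> Cmod (G w - G z)%C < eps.

Definition path_cont (f : R -> C) (t : R) : Prop :=
  forall eps, 0 < eps -> exists delta, 0 < delta /\
    forall s, Rabs (s - t) < delta -> Cmod (f s - f t)%C < eps.

Lemma path_cont_CInt f a b :
  (forall t, Rmin a b <= t <= Rmax a b -> path_cont f t) -> is_CInt f a b (CInt f a b).
Proof.
  intros Hc.
  split; apply (@RInt_correct R_CompleteNormedModule); apply (@ex_RInt_continuous R_CompleteNormedModule);
  intros t Ht; apply continuity_pt_filterlim; intros eps Heps;
  destruct (Hc t Ht eps Heps) as [d [Hd H]]; exists d; (split; [exact Hd|]);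
  intros s [_ Hs]; specialize (H s Hs); simpl; unfold R_dist.
  - eapply Rle_lt_trans; [|exact H]. apply (re_le_Cmod (f s - f t)%C).
  - eapply Rle_lt_trans; [|exact H]. apply (im_le_Cmod (f s - f t)%C).
Qed.

Lemma cont_at_comp_path G (f : R -> C) t :
  path_cont f t -> cont_at G (f t) -> path_cont (fun s => G (f s)) t.
Proof.
  intros Hf HG eps He. destruct (HG eps He) as [d [Hd H]].
  destruct (Hf d Hd) as [d' [Hd' H']]. exists d'. split; auto.
Qed.

Lemma path_cont_h y t : path_cont (fun x => (x, y)) t.
Proof.
  intros eps He. exists eps. split; auto. intros s Hs.
  eapply Rle_lt_trans; [apply Cmod_le_sum|]. simpl.
  replace (y + - y) with 0 by ring. rewrite Rabs_R0. unfold Rminus in Hs. lra.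
Qed.

Lemma path_cont_v x t : path_cont (fun y => (x, y)) t.
Proof.
  intros eps He. exists eps. split; auto. intros s Hs.
  eapply Rle_lt_trans; [apply Cmod_le_sum|]. simpl.
  replace (x + - x) with 0 by ring. rewrite Rabs_R0. unfold Rminus in Hs. lra.
Qed.

(** * Goursat's lemma *)

(** Stated without division, so that the estimate can be integrated along a
    path that passes through [z]. *)
Definition diff_at (f : C -> C) (z l : C) : Prop :=
  forall eps, 0 < eps -> exists delta, 0 < delta /\
    forall w, Cmod (w - z)%C < delta ->
      Cmod (f w - f z - l * (w - z))%C <= eps * Cmod (w - z)%C.

Lemma diff_at_cont f z l : diff_at f z l -> cont_at f z.
Proof.
  intros H eps He. destruct (H 1 Rlt_0_1) as [d [Hd Hw]].
  assert (Hl := Cmod_ge_0 l).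
  exists (Rmin d (eps / (Cmod l + 2))). split.
  { apply Rmin_pos; auto. apply Rdiv_lt_0_compat; lra. }
  intros w Hz.
  assert (H1 := Hw w (Rlt_le_trans _ _ _ Hz (Rmin_l _ _))).
  assert (H2 := Rlt_le_trans _ _ _ Hz (Rmin_r _ _)).
  replace (f w - f z)%C with ((f w - f z - l * (w - z)) + l * (w - z))%C by ring.
  eapply Rle_lt_trans; [apply Cmod_triangle|]. rewrite Cmod_mult.
  assert (H3 : Cmod (w - z)%C * (Cmod l + 2) < eps).
  { apply (Rmult_lt_compat_r (Cmod l + 2)) in H2; [|lra].
    replace (eps / (Cmod l + 2) * (Cmod l + 2)) with eps in H2 by (field; lra). exact H2. }
  assert (H4 := Cmod_ge_0 (w - z)%C). nra.
Qed.

(** The integral of [H] over the boundary of a rectangle, opposite sides being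
    grouped so that the linear part of [H] leaves constant integrands. *)
Definition rect_int (H : C -> C) (x1 x2 y1 y2 : R) : C :=
  (CInt (fun x => H (x, y1) - H (x, y2)) x1 x2
   + CInt (fun y => Ci * (H (x2, y) - H (x1, y))) y1 y2)%C.

Section Rect.
Variables (H : C -> C) (a b c d : R).
Hypothesis Hcont : forall x y, a <= x <= b -> c <= y <= d -> cont_at H (x, y).

Lemma is_CInt_h x1 x2 y : a <= x1 -> x1 <= x2 -> x2 <= b -> c <= y <= d ->
  is_CInt (fun x => H (x, y)) x1 x2 (CInt (fun x => H (x, y)) x1 x2).
Proof.
  intros h1 h2 h3 h4. apply path_cont_CInt. intros t.
  rewrite Rmin_left, Rmax_right by lra. intros Ht.
  apply (cont_at_comp_path H (fun x => (x, y))).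
  apply path_cont_h. apply Hcont; lra.
Qed.

Lemma is_CInt_v y1 y2 x : c <= y1 -> y1 <= y2 -> y2 <= d -> a <= x <= b ->
  is_CInt (fun y => H (x, y)) y1 y2 (CInt (fun y => H (x, y)) y1 y2).
Proof.
  intros h1 h2 h3 h4. apply path_cont_CInt. intros t.
  rewrite Rmin_left, Rmax_right by lra. intros Ht.
  apply (cont_at_comp_path H (fun y => (x, y))).
  apply path_cont_v. apply Hcont; lra.
Qed.

Lemma rect_int_eq x1 x2 y1 y2 :
  a <= x1 -> x1 <= x2 -> x2 <= b -> c <= y1 -> y1 <= y2 -> y2 <= d ->
  rect_int H x1 x2 y1 y2 =
  (CInt (fun x => H (x, y1)) x1 x2 - CInt (fun x => H (x, y2)) x1 x2
   + Ci * (CInt (fun y => H (x2, y)) y1 y2 - CInt (fun y => H (x1, y)) y1 y2))%C.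
Proof.
  intros. unfold rect_int. f_equal; apply is_CInt_unique.
  - apply is_CInt_minus; apply is_CInt_h; lra.
  - apply is_CInt_scal, is_CInt_minus; apply is_CInt_v; lra.
Qed.

Lemma rect_int_split_x x1 x2 x3 y1 y2 :
  a <= x1 -> x1 <= x2 -> x2 <= x3 -> x3 <= b -> c <= y1 -> y1 <= y2 -> y2 <= d ->
  rect_int H x1 x3 y1 y2 = (rect_int H x1 x2 y1 y2 + rect_int H x2 x3 y1 y2)%C.
Proof.
  intros. rewrite !rect_int_eq by lra.
  rewrite (is_CInt_unique (fun x => H (x, y1)) x1 x3
    (CInt (fun x => H (x, y1)) x1 x2 + CInt (fun x => H (x, y1)) x2 x3)%C).
  rewrite (is_CInt_unique (fun x => H (x, y2)) x1 x3
    (CInt (fun x => H (x, y2)) x1 x2 + CInt (fun x => H (x, y2)) x2 x3)%C).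
  ring.
  all: eapply is_CInt_Chasles; apply is_CInt_h; lra.
Qed.

Lemma rect_int_split_y x1 x2 y1 y2 y3 :
  a <= x1 -> x1 <= x2 -> x2 <= b -> c <= y1 -> y1 <= y2 -> y2 <= y3 -> y3 <= d ->
  rect_int H x1 x2 y1 y3 = (rect_int H x1 x2 y1 y2 + rect_int H x1 x2 y2 y3)%C.
Proof.
  intros. rewrite !rect_int_eq by lra.
  rewrite (is_CInt_unique (fun y => H (x1, y)) y1 y3
    (CInt (fun y => H (x1, y)) y1 y2 + CInt (fun y => H (x1, y)) y2 y3)%C).
  rewrite (is_CInt_unique (fun y => H (x2, y)) y1 y3
    (CInt (fun y => H (x2, y)) y1 y2 + CInt (fun y => H (x2, y)) y2 y3)%C).
  ring.
  all: eapply is_CInt_Chasles; apply is_CInt_v; lra.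
Qed.

(** An affine function has integral zero over the boundary of a rectangle, so
    only the deviation of [H] from it counts, integrated over the perimeter. *)
Lemma rect_int_le_affine x1 x2 y1 y2 (l p v : C) (M : R) :
  a <= x1 -> x1 <= x2 -> x2 <= b -> c <= y1 -> y1 <= y2 -> y2 <= d ->
  (forall x y, x1 <= x <= x2 -> y1 <= y <= y2 ->
     Cmod (H (x, y) - v - l * ((x, y) - p))%C <= M) ->
  Cmod (rect_int H x1 x2 y1 y2) <= 2 * M * ((x2 - x1) + (y2 - y1)).
Proof.
  intros h1 h2 h3 h4 h5 h6 HM.
  set (e := fun z => (H z - v - l * (z - p))%C).
  assert (E1 : is_CInt (fun x => e (x, y1) - e (x, y2))%C x1 x2
    (CInt (fun x => H (x, y1) - H (x, y2)) x1 x2 - RtoC (x2 - x1) * (- l * Ci * RtoC (y2 - y1)))%C).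
  { eapply is_CInt_ext.
    2:{ apply is_CInt_minus; [|apply is_CInt_const].
        assert (E := is_CInt_minus _ _ _ _ _ _ (is_CInt_h x1 x2 y1 ltac:(lra) ltac:(lra) ltac:(lra) ltac:(lra))
           (is_CInt_h x1 x2 y2 ltac:(lra) ltac:(lra) ltac:(lra) ltac:(lra))).
        rewrite (is_CInt_unique _ _ _ _ E). exact E. }
    intros t _. unfold e.
    apply injective_projections; simpl; ring. }
  assert (E2 : is_CInt (fun y => Ci * (e (x2, y) - e (x1, y)))%C y1 y2
    (CInt (fun y => Ci * (H (x2, y) - H (x1, y))) y1 y2 - RtoC (y2 - y1) * (Ci * l * RtoC (x2 - x1)))%C).
  { eapply is_CInt_ext.
    2:{ apply is_CInt_minus; [|apply is_CInt_const].
        assert (E := is_CInt_scal _ _ _ _ Ci (is_CInt_minus _ _ _ _ _ _ (is_CInt_v y1 y2 x2 ltac:(lra) ltac:(lra) ltac:(lra) ltac:(lra))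
           (is_CInt_v y1 y2 x1 ltac:(lra) ltac:(lra) ltac:(lra) ltac:(lra)))).
        rewrite (is_CInt_unique _ _ _ _ E). exact E. }
    intros t _. unfold e.
    apply injective_projections; simpl; ring. }
  apply is_CInt_le_const with (M := 2 * M) in E1; [|lra|].
  2:{ intros t Ht. eapply Rle_trans; [apply Cmod_minus_triangle|].
      assert (Cmod (e (t, y1)) <= M) by (apply HM; lra).
      assert (Cmod (e (t, y2)) <= M) by (apply HM; lra). lra. }
  apply is_CInt_le_const with (M := 2 * M) in E2; [|lra|].
  2:{ intros t Ht. rewrite Cmod_mult, Cmod_Ci, Rmult_1_l.
      eapply Rle_trans; [apply Cmod_minus_triangle|].
      assert (Cmod (e (x1, t)) <= M) by (apply HM; lra).
      assert (Cmod (e (x2, t)) <= M) by (apply HM; lra). lra. }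
  unfold rect_int.
  match type of E1 with Cmod ?u <= _ => match type of E2 with Cmod ?w <= _ =>
    replace (CInt _ _ _ + CInt _ _ _)%C with (u + w)%C by ring end end.
  eapply Rle_trans; [apply Cmod_triangle|]. lra.
Qed.
End Rect.

(** The boundary integral is the sum of those of the four quadrants, so one of
    them carries at least a quarter of its modulus. *)
Lemma rect_quadrant H a b c d x y u v :
  (forall x y, a <= x <= b -> c <= y <= d -> cont_at H (x, y)) ->
  0 <= u -> 0 <= v -> a <= x -> x + 2 * u <= b -> c <= y -> y + 2 * v <= d ->
  exists x' y', x <= x' <= x + u /\ y <= y' <= y + v /\
    Cmod (rect_int H x (x + 2 * u) y (y + 2 * v))
      <= 4 * Cmod (rect_int H x' (x' + u) y' (y' + v)).
Proof.
  intros Hc Hu Hv h1 h2 h3 h4.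
  rewrite (rect_int_split_x H a b c d Hc x (x + u) (x + 2 * u)) by lra.
  rewrite (rect_int_split_y H a b c d Hc x (x + u) y (y + v) (y + 2 * v)) by lra.
  rewrite (rect_int_split_y H a b c d Hc (x + u) (x + 2 * u) y (y + v) (y + 2 * v)) by lra.
  replace (x + 2 * u) with (x + u + u) by ring.
  replace (y + 2 * v) with (y + v + v) by ring.
  set (A := rect_int H x (x + u) y (y + v)).
  set (B := rect_int H x (x + u) (y + v) (y + v + v)).
  set (D := rect_int H (x + u) (x + u + u) y (y + v)).
  set (E := rect_int H (x + u) (x + u + u) (y + v) (y + v + v)).
  assert (T : Cmod (A + B + (D + E))%C <= Cmod A + Cmod B + Cmod D + Cmod E).
  { assert (T1 := Cmod_triangle (A + B)%C (D + E)%C).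
    assert (T2 := Cmod_triangle A B). assert (T3 := Cmod_triangle D E). lra. }
  set (S := Cmod (A + B + (D + E))%C) in *.
  destruct (Rle_dec S (4 * Cmod A)). { exists x, y. repeat split; try lra; assumption. }
  destruct (Rle_dec S (4 * Cmod B)). { exists x, (y + v). repeat split; try lra; assumption. }
  destruct (Rle_dec S (4 * Cmod D)). { exists (x + u), y. repeat split; try lra; assumption. }
  exists (x + u), (y + v). repeat split; try lra. fold E. lra.
Qed.

Lemma nested_intervals (X : nat -> R) (u : R) :
  0 <= u -> (forall n, X n <= X (S n) <= X n + u / 2 ^ (S n)) ->
  exists x, forall n, X n <= x <= X n + u / 2 ^ n.
Proof.
  intros Hu HX.
  assert (Hp : forall n, 0 < 2 ^ n) by (intros; apply pow_lt; lra).
  assert (D : forall n, u / 2 ^ n = 2 * (u / 2 ^ (S n))).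
  { intros n. simpl. field. apply Rgt_not_eq, Hp. }
  assert (M : forall n k, X n <= X (n + k)%nat /\ X (n + k)%nat + u / 2 ^ (n + k) <= X n + u / 2 ^ n).
  { intros n. induction k as [|k [I1 I2]].
    - rewrite Nat.add_0_r. lra.
    - rewrite Nat.add_succ_r. assert (h := HX (n + k)%nat). assert (h' := D (n + k)%nat). lra. }
  assert (Q : forall n, 0 <= u / 2 ^ n).
  { intros n. apply Rmult_le_pos; auto. left. apply Rinv_0_lt_compat, Hp. }
  destruct (ex_finite_lim_seq_incr X (X 0%nat + u / 2 ^ 0)) as [x Hx].
  { intros n. apply HX. }
  { intros n. assert (h := M 0%nat n). rewrite Nat.add_0_l in h. assert (h' := Q n). lra. }
  exists x. intros n. split.
  - apply (is_lim_seq_incr_compare X x Hx). intros k; apply HX.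
  - assert (L : Rbar_le x (X n + u / 2 ^ n)); [|exact L].
    apply (is_lim_seq_le (fun k => X (n + k)%nat) (fun _ => X n + u / 2 ^ n)).
    + intros k. assert (h := M n k). assert (h' := Q (n + k)%nat). lra.
    + apply is_lim_seq_ext with (fun k => X (k + n)%nat).
      intros k. now rewrite Nat.add_comm. now apply -> (is_lim_seq_incr_n X n).
    + apply is_lim_seq_const.
Qed.

(** If the integral were nonzero, repeated bisection would give nested
    rectangles on which it decreases at most like the area. Near their common
    point [H] is affine up to a small multiple of the diameter, which makes the
    integral negligible compared with the area. *)
Lemma goursat H a b c d :
  a <= b -> c <= d ->
  (forall x y, a <= x <= b -> c <= y <= d -> exists l, diff_at H (x, y) l) ->
  rect_int H a b c d = RtoC 0.
Proof.
  intros Hab Hcd Hd.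
  assert (Hc : forall x y, a <= x <= b -> c <= y <= d -> cont_at H (x, y)).
  { intros x y h1 h2. destruct (Hd x y h1 h2) as [l Hl]. eapply diff_at_cont; eauto. }
  set (u := b - a). set (v := d - c).
  assert (Hu : 0 <= u) by (unfold u; lra). assert (Hv : 0 <= v) by (unfold v; lra).
  assert (Hp : forall n, 0 < 2 ^ n) by (intros; apply pow_lt; lra).
  assert (Dv : forall w n, w / 2 ^ n = 2 * (w / 2 ^ (S n))).
  { intros w n. simpl. field. apply Rgt_not_eq, Hp. }
  assert (Q : forall w n, 0 <= w -> 0 <= w / 2 ^ n).
  { intros w n Hw. apply Rmult_le_pos; auto. left. apply Rinv_0_lt_compat, Hp. }
  set (J := fun n (p : R * R) => Cmod (rect_int H (fst p) (fst p + u / 2 ^ n) (snd p) (snd p + v / 2 ^ n))).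
  set (inside := fun n (p : R * R) =>
     a <= fst p /\ fst p + u / 2 ^ n <= b /\ c <= snd p /\ snd p + v / 2 ^ n <= d).
  assert (step : forall q : nat * (R * R), exists p', inside (fst q) (snd q) ->
     fst (snd q) <= fst p' <= fst (snd q) + u / 2 ^ (S (fst q)) /\
     snd (snd q) <= snd p' <= snd (snd q) + v / 2 ^ (S (fst q)) /\
     J (fst q) (snd q) <= 4 * J (S (fst q)) p').
  { intros [n p]. simpl fst; simpl snd. destruct (classic (inside n p)) as [[h1 [h2 [h3 h4]]]|hn].
    2:{ exists p. intros; contradiction. }
    rewrite (Dv u) in h2. rewrite (Dv v) in h4.
    destruct (rect_quadrant H a b c d (fst p) (snd p) (u / 2 ^ S n) (v / 2 ^ S n) Hc
      (Q _ _ Hu) (Q _ _ Hv) h1 h2 h3 h4) as [x' [y' [g1 [g2 g3]]]].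
    exists (x', y'). intros _. simpl fst; simpl snd. split; [exact g1|split;[exact g2|]].
    unfold J. rewrite (Dv u n), (Dv v n). exact g3. }
  apply functional_choice in step. destruct step as [F HF].
  set (P := fix P n := match n with O => (a, c) | S n => F (n, P n) end).
  assert (Hin : forall n, inside n (P n)).
  { induction n as [|n IH].
    - unfold inside, u, v; simpl. repeat split; lra.
    - destruct (HF (n, P n) IH) as [g1 [g2 _]]. cbn [fst snd] in g1, g2.
      destruct IH as [h1 [h2 [h3 h4]]]. rewrite (Dv u) in h2. rewrite (Dv v) in h4.
      change (P (S n)) with (F (n, P n)). unfold inside. repeat split; lra. }
  assert (HP : forall n, fst (P n) <= fst (P (S n)) <= fst (P n) + u / 2 ^ S n /\
     snd (P n) <= snd (P (S n)) <= snd (P n) + v / 2 ^ S n /\ J n (P n) <= 4 * J (S n) (P (S n))).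
  { intros n. exact (HF (n, P n) (Hin n)). }
  destruct (nested_intervals (fun n => fst (P n)) u Hu) as [x Hx]. { intros n; apply (HP n). }
  destruct (nested_intervals (fun n => snd (P n)) v Hv) as [y Hy]. { intros n; apply (HP n). }
  assert (HJ : forall n, J O (P O) <= 4 ^ n * J n (P n)).
  { induction n as [|n IH]. simpl; lra.
    assert (h := HP n). destruct h as [_ [_ h]].
    eapply Rle_trans; [exact IH|]. change (4 ^ S n) with (4 * 4 ^ n).
    assert (0 < 4 ^ n) by (apply pow_lt; lra). nra. }
  assert (Hxy : a <= x <= b /\ c <= y <= d).
  { assert (h1 := Hx O). assert (h2 := Hy O). simpl in h1, h2. unfold u, v in *. lra. }
  destruct (Hd x y (proj1 Hxy) (proj2 Hxy)) as [l Hl].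
  (* At depth [n] both the perimeter and the distance to [(x, y)] are of order
     [(u + v) / 2 ^ n]; the factor [4 ^ n] lost by bisection compensates their
     product exactly. *)
  assert (K : forall eps, 0 < eps -> J O (P O) <= 2 * eps * (u + v) ^ 2).
  { intros eps He. destruct (Hl eps He) as [dl [Hdl Hw]].
    destruct (pow_lt_1_zero (/ 2) ltac:(rewrite Rabs_right; lra) (dl / (u + v + 1))) as [n Hn].
    { apply Rdiv_lt_0_compat; lra. }
    specialize (Hn n (le_n n)). rewrite Rabs_right in Hn.
    2:{ apply Rle_ge, pow_le; lra. }
    assert (Hs : (u + v) / 2 ^ n < dl).
    { assert (h := Hp n). rewrite pow_inv in Hn by lra.
      apply (Rmult_lt_compat_r (u + v + 1)) in Hn; [|lra].
      replace (dl / (u + v + 1) * (u + v + 1)) with dl in Hn by (field; lra).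
      assert (0 < / 2 ^ n) by (apply Rinv_0_lt_compat, Hp). unfold Rdiv. nra. }
    assert (Sp : (u + v) / 2 ^ n = u / 2 ^ n + v / 2 ^ n) by (unfold Rdiv; ring).
    destruct (Hin n) as [h1 [h2 [h3 h4]]].
    assert (g1 := Hx n). assert (g2 := Hy n). cbn beta in g1, g2.
    assert (B := rect_int_le_affine H a b c d Hc (fst (P n)) (fst (P n) + u / 2 ^ n)
      (snd (P n)) (snd (P n) + v / 2 ^ n) l (x, y) (H (x, y)) (eps * ((u + v) / 2 ^ n))).
    eapply Rle_trans; [apply (HJ n)|].
    assert (B' : J n (P n) <= 2 * (eps * ((u + v) / 2 ^ n)) * ((u + v) / 2 ^ n)).
    { unfold J. eapply Rle_trans; [apply B|].
      all: assert (Qu := Q u n Hu); assert (Qv := Q v n Hv); try lra.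
      intros x' y' k1 k2.
      assert (k : Cmod ((x', y') - (x, y))%C <= (u + v) / 2 ^ n).
      { eapply Rle_trans; [apply Cmod_le_sum|]. simpl.
        rewrite Sp. apply Rplus_le_compat; apply Rabs_le; lra. }
      eapply Rle_trans; [apply Hw; lra|]. apply Rmult_le_compat_l; lra. }
    replace (2 * eps * (u + v) ^ 2) with (4 ^ n * (2 * (eps * ((u + v) / 2 ^ n)) * ((u + v) / 2 ^ n))).
    { apply Rmult_le_compat_l; [apply pow_le; lra|exact B']. }
    replace 4 with (2 * 2) by ring. rewrite Rpow_mult_distr. field. apply Rgt_not_eq, Hp. }
  assert (E : J O (P O) = Cmod (rect_int H a b c d)).
  { unfold J, u, v. simpl. f_equal. f_equal; field. }
  rewrite E in K. apply Cmod_eq_0.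
  assert (G := Cmod_ge_0 (rect_int H a b c d)).
  destruct (Req_dec (Cmod (rect_int H a b c d)) 0) as [|ne]; auto. exfalso.
  set (m := Cmod (rect_int H a b c d)) in *.
  assert (W : 0 < 2 * (u + v) ^ 2 + 1) by (assert (h := pow2_ge_0 (u + v)); lra).
  specialize (K (m / (2 * (u + v) ^ 2 + 1))).
  assert (0 < m / (2 * (u + v) ^ 2 + 1)) by (apply Rdiv_lt_0_compat; lra).
  specialize (K H0).
  assert (m / (2 * (u + v) ^ 2 + 1) * (2 * (u + v) ^ 2 + 1) = m) by (field; lra). nra.
Qed.

(** Only a small square around [p] contributes to the boundary integral, and
    its contribution is at most the oscillation of [H] near [p] times the
    perimeter. *)
Lemma goursat_except H a b c d (p : C) :
  a < Re p < b -> c < Im p < d ->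
  (forall x y, a <= x <= b -> c <= y <= d -> cont_at H (x, y)) ->
  (forall x y, a <= x <= b -> c <= y <= d -> (x, y) <> p -> exists l, diff_at H (x, y) l) ->
  rect_int H a b c d = RtoC 0.
Proof.
  destruct p as [u v]. simpl Re; simpl Im. intros Hu Hv Hc Hd.
  destruct (Hc u v ltac:(lra) ltac:(lra) 1 Rlt_0_1) as [dl [Hdl Hw]].
  apply Cmod_eq_0. apply Rle_antisym; [|apply Cmod_ge_0].
  apply Rnot_lt_le. intros Hpos.
  set (m := Cmod (rect_int H a b c d)) in *.
  set (e := Rmin (Rmin (Rmin (u - a) (b - u)) (Rmin (v - c) (d - v))) (Rmin (dl / 4) (m / 16))).
  assert (He : 0 < e) by (unfold e; repeat apply Rmin_pos; lra).
  assert (E1 : e <= Rmin (Rmin (u - a) (b - u)) (Rmin (v - c) (d - v))) by apply Rmin_l.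
  assert (E2 : e <= Rmin (dl / 4) (m / 16)) by apply Rmin_r.
  assert (F1 := Rle_trans _ _ _ E1 (Rmin_l _ _)). assert (F2 := Rle_trans _ _ _ E1 (Rmin_r _ _)).
  assert (e1 := Rle_trans _ _ _ F1 (Rmin_l _ _)). assert (e2 := Rle_trans _ _ _ F1 (Rmin_r _ _)).
  assert (e3 := Rle_trans _ _ _ F2 (Rmin_l _ _)). assert (e4 := Rle_trans _ _ _ F2 (Rmin_r _ _)).
  assert (e5 := Rle_trans _ _ _ E2 (Rmin_l _ _)). assert (e6 := Rle_trans _ _ _ E2 (Rmin_r _ _)).
  clear E1 E2 F1 F2.
  assert (Z : forall x1 x2 y1 y2, a <= x1 -> x1 <= x2 -> x2 <= b -> c <= y1 -> y1 <= y2 -> y2 <= d ->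
    (u < x1 \/ x2 < u \/ v < y1 \/ y2 < v) -> rect_int H x1 x2 y1 y2 = RtoC 0).
  { intros. apply goursat; auto. intros x y h1 h2. apply Hd; try lra.
    intros q; injection q; intros; subst; lra. }
  assert (Eq : rect_int H a b c d = rect_int H (u - e / 2) (u + e / 2) (v - e / 2) (v + e / 2)).
  { rewrite (rect_int_split_x H a b c d Hc a (u - e / 2) b) by lra.
    rewrite (rect_int_split_x H a b c d Hc (u - e / 2) (u + e / 2) b) by lra.
    rewrite (rect_int_split_y H a b c d Hc (u - e / 2) (u + e / 2) c (v - e / 2) d) by lra.
    rewrite (rect_int_split_y H a b c d Hc (u - e / 2) (u + e / 2) (v - e / 2) (v + e / 2) d) by lra.
    rewrite (Z a (u - e / 2)) by lra. rewrite (Z (u + e / 2) b) by lra.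
    rewrite (Z (u - e / 2) (u + e / 2) c (v - e / 2)) by lra.
    rewrite (Z (u - e / 2) (u + e / 2) (v + e / 2) d) by lra. ring. }
  assert (B : m <= 2 * 1 * (((u + e / 2) - (u - e / 2)) + ((v + e / 2) - (v - e / 2)))).
  { unfold m. rewrite Eq. apply (rect_int_le_affine H a b c d Hc) with (l := RtoC 0) (p := RtoC 0) (v := H (u, v)); try lra.
    intros x y h1 h2.
    replace (H (x, y) - H (u, v) - RtoC 0 * ((x, y) - RtoC 0))%C with (H (x, y) - H (u, v))%C by ring.
    left. apply Hw. eapply Rle_lt_trans; [apply Cmod_le_sum|]. simpl.
    assert (Rabs (x + - u) <= e / 2) by (apply Rabs_le; lra).
    assert (Rabs (y + - v) <= e / 2) by (apply Rabs_le; lra). lra. }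
  lra.
Qed.

(** * Complex differentiability *)

Lemma cont_at_const c z : cont_at (fun _ => c) z.
Proof.
  intros eps He. exists 1. split; [lra|]. intros w _.
  replace (c - c)%C with (RtoC 0) by ring. now rewrite Cmod_0.
Qed.

Lemma cont_at_id z : cont_at (fun w => w) z.
Proof. intros eps He. exists eps. auto. Qed.

Lemma cont_at_plus f g z : cont_at f z -> cont_at g z -> cont_at (fun w => f w + g w)%C z.
Proof.
  intros Hf Hg eps He.
  destruct (Hf (eps / 2) ltac:(lra)) as [d1 [H1 K1]].
  destruct (Hg (eps / 2) ltac:(lra)) as [d2 [H2 K2]].
  exists (Rmin d1 d2). split; [apply Rmin_pos; auto|]. intros w Hw.
  specialize (K1 w (Rlt_le_trans _ _ _ Hw (Rmin_l _ _))).
  specialize (K2 w (Rlt_le_trans _ _ _ Hw (Rmin_r _ _))).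
  replace (f w + g w - (f z + g z))%C with ((f w - f z) + (g w - g z))%C by ring.
  eapply Rle_lt_trans; [apply Cmod_triangle|]. lra.
Qed.

Lemma cont_at_mult f g z : cont_at f z -> cont_at g z -> cont_at (fun w => f w * g w)%C z.
Proof.
  intros Hf Hg eps He.
  assert (P1 := Cmod_ge_0 (f z)). assert (P2 := Cmod_ge_0 (g z)).
  (* Small enough that [k * (|f z| + |g z| + k) < eps]. *)
  set (k := eps / (Cmod (f z) + Cmod (g z) + 1 + eps)).
  assert (Hk : 0 < k) by (apply Rdiv_lt_0_compat; lra).
  assert (Ek : k * (Cmod (f z) + Cmod (g z) + 1 + eps) = eps) by (unfold k; field; lra).
  assert (k < 1) by nra.
  destruct (Hf k Hk) as [d1 [H1 K1]]. destruct (Hg k Hk) as [d2 [H2 K2]].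
  exists (Rmin d1 d2). split; [apply Rmin_pos; auto|]. intros w Hw.
  specialize (K1 w (Rlt_le_trans _ _ _ Hw (Rmin_l _ _))).
  specialize (K2 w (Rlt_le_trans _ _ _ Hw (Rmin_r _ _))).
  replace (f w * g w - f z * g z)%C
    with ((f w - f z) * (g w - g z) + (f w - f z) * g z + f z * (g w - g z))%C by ring.
  eapply Rle_lt_trans; [apply Cmod_triangle|].
  eapply Rle_lt_trans; [apply Rplus_le_compat_r, Cmod_triangle|]. rewrite !Cmod_mult.
  assert (P3 := Cmod_ge_0 (f w - f z)%C). assert (P4 := Cmod_ge_0 (g w - g z)%C).
  set (x := Cmod (f w - f z)%C) in *. set (y := Cmod (g w - g z)%C) in *.
  assert (x * y <= k * 1) by (apply Rmult_le_compat; lra).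
  assert (x * Cmod (g z) <= k * Cmod (g z)) by (apply Rmult_le_compat_r; lra).
  assert (Cmod (f z) * y <= Cmod (f z) * k) by (apply Rmult_le_compat_l; lra).
  assert (0 < k * eps) by (apply Rmult_lt_0_compat; lra). lra.
Qed.

Lemma cont_at_comp f g z : cont_at f z -> cont_at g (f z) -> cont_at (fun w => g (f w)) z.
Proof.
  intros Hf Hg eps He. destruct (Hg eps He) as [d [Hd H]].
  destruct (Hf d Hd) as [d' [Hd' H']]. exists d'. split; auto.
Qed.

Lemma cont_at_inv z : z <> RtoC 0 -> cont_at Cinv z.
Proof.
  intros Hz eps He. assert (P := proj1 (Cmod_gt_0 z) Hz).
  set (m := Cmod z) in *.
  exists (Rmin (m / 2) (eps * (m * m / 2))). split.
  { apply Rmin_pos; [lra|]. repeat apply Rmult_lt_0_compat; lra. }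
  intros w Hw.
  assert (K1 := Rlt_le_trans _ _ _ Hw (Rmin_l _ _)).
  assert (K2 := Rlt_le_trans _ _ _ Hw (Rmin_r _ _)).
  assert (Q : m / 2 < Cmod w).
  { assert (T := Cmod_triangle_rev z w). rewrite Cmod_minus_sym in T. fold m in T. lra. }
  assert (Hw0 : w <> RtoC 0) by (apply Cmod_gt_0; lra).
  replace (/ w - / z)%C with (- (w - z) * / (w * z))%C by (field; auto).
  rewrite Cmod_mult, Cmod_opp, Cmod_inv, Cmod_mult by (apply Cmult_neq_0; auto). fold m.
  apply Rmult_lt_reg_r with (Cmod w * m). { apply Rmult_lt_0_compat; lra. }
  rewrite Rmult_assoc, Rinv_l, Rmult_1_r.
  2:{ apply Rmult_integral_contrapositive; lra. }
  eapply Rlt_trans; [exact K2|]. apply Rmult_lt_compat_l; auto. nra.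
Qed.

(** Carathéodory's form of differentiability, from which the product, quotient
    and chain rules are algebra. *)
Lemma diff_at_caratheodory f z l :
  diff_at f z l ->
  exists phi, cont_at phi z /\ phi z = l /\ forall w, f w = (f z + phi w * (w - z))%C.
Proof.
  intros H.
  exists (fun w => if Ceq_dec w z then l else ((f w - f z) / (w - z))%C).
  assert (E : (if Ceq_dec z z then l else ((f z - f z) / (z - z))%C) = l).
  { destruct (Ceq_dec z z); congruence. }
  split; [|split; [exact E|]].
  - intros eps He. rewrite E. destruct (H (eps / 2) ltac:(lra)) as [d [Hd K]].
    exists d. split; auto. intros w Hw. destruct (Ceq_dec w z) as [e|ne].
    { replace (l - l)%C with (RtoC 0) by ring. now rewrite Cmod_0. }
    assert (ne' := Cminus_eq_contra _ _ ne).
    assert (P := proj1 (Cmod_gt_0 _) ne').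
    replace ((f w - f z) / (w - z) - l)%C with ((f w - f z - l * (w - z)) / (w - z))%C by (field; auto).
    rewrite Cmod_div by auto. apply Rmult_lt_reg_r with (Cmod (w - z)%C); auto.
    unfold Rdiv. rewrite Rmult_assoc, Rinv_l, Rmult_1_r by lra.
    eapply Rle_lt_trans; [apply K; auto|]. apply Rmult_lt_compat_r; lra.
  - intros w. destruct (Ceq_dec w z) as [e|ne].
    + rewrite e. ring.
    + field. apply Cminus_eq_contra; auto.
Qed.

Lemma caratheodory_diff_at f z phi d :
  0 < d -> cont_at phi z ->
  (forall w, Cmod (w - z)%C < d -> f w = (f z + phi w * (w - z))%C) -> diff_at f z (phi z).
Proof.
  intros Hd Hc E eps He. destruct (Hc eps He) as [d' [Hd' K]].
  exists (Rmin d d'). split; [apply Rmin_pos; auto|]. intros w Hw.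
  rewrite (E w) by (eapply Rlt_le_trans; [exact Hw|apply Rmin_l]).
  replace (f z + phi w * (w - z) - f z - phi z * (w - z))%C with ((phi w - phi z) * (w - z))%C by ring.
  rewrite Cmod_mult. apply Rmult_le_compat_r; [apply Cmod_ge_0|].
  left. apply K. eapply Rlt_le_trans; [exact Hw|apply Rmin_r].
Qed.

Definition differentiable (f : C -> C) (z : C) : Prop := exists l, diff_at f z l.

Lemma differentiable_cont f z : differentiable f z -> cont_at f z.
Proof. intros [l H]. eapply diff_at_cont; eauto. Qed.

Lemma differentiable_ext_loc f g z d :
  0 < d -> (forall w, Cmod (w - z)%C < d -> f w = g w) -> differentiable f z -> differentiable g z.
Proof.
  intros Hd E [l H]. exists l. intros eps He. destruct (H eps He) as [d' [Hd' K]].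
  exists (Rmin d d'). split; [apply Rmin_pos; auto|]. intros w Hw.
  rewrite <- !E. { apply K. eapply Rlt_le_trans; [exact Hw|apply Rmin_r]. }
  - replace (z - z)%C with (RtoC 0) by ring. now rewrite Cmod_0.
  - eapply Rlt_le_trans; [exact Hw|apply Rmin_l].
Qed.

Lemma differentiable_id z : differentiable (fun w => w) z.
Proof.
  exists (RtoC 1). apply (caratheodory_diff_at _ z (fun _ => RtoC 1) 1); [lra|apply cont_at_const|].
  intros w _. ring.
Qed.

Lemma differentiable_affine b z : differentiable (fun w => w - b)%C z.
Proof.
  exists (RtoC 1). apply (caratheodory_diff_at _ z (fun _ => RtoC 1) 1); [lra|apply cont_at_const|].
  intros w _. ring.
Qed.

Lemma differentiable_minus_const f b z : differentiable f z -> differentiable (fun w => f w - b)%C z.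
Proof.
  intros [l H]. exists l. intros eps He. destruct (H eps He) as [d [Hd K]]. exists d. split; auto.
  intros w Hw. replace (f w - b - (f z - b) - l * (w - z))%C with (f w - f z - l * (w - z))%C by ring.
  auto.
Qed.

Lemma differentiable_mult f g z :
  differentiable f z -> differentiable g z -> differentiable (fun w => f w * g w)%C z.
Proof.
  intros [l Hf] [m Hg].
  assert (Cg := diff_at_cont _ _ _ Hg).
  apply diff_at_caratheodory in Hf. destruct Hf as [p [Cp [_ Ef]]].
  apply diff_at_caratheodory in Hg. destruct Hg as [q [Cq [_ Eg]]].
  eexists. apply (caratheodory_diff_at _ z (fun w => p w * g w + f z * q w)%C 1); [lra| |].
  - apply cont_at_plus; apply cont_at_mult; auto. apply cont_at_const.
  - intros w _. rewrite (Ef w).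
    replace ((f z + p w * (w - z)) * g w)%C with (f z * g w + p w * g w * (w - z))%C by ring.
    replace (f z * g w)%C with (f z * (g z + q w * (w - z)))%C by (now rewrite <- Eg). ring.
Qed.

Lemma differentiable_comp f g z :
  differentiable f z -> differentiable g (f z) -> differentiable (fun w => g (f w)) z.
Proof.
  intros [l Hf] [m Hg].
  assert (Cf := diff_at_cont _ _ _ Hf).
  apply diff_at_caratheodory in Hf. destruct Hf as [p [Cp [_ Ef]]].
  apply diff_at_caratheodory in Hg. destruct Hg as [q [Cq [_ Eg]]].
  eexists. apply (caratheodory_diff_at _ z (fun w => q (f w) * p w)%C 1); [lra| |].
  - apply cont_at_mult; auto. apply (cont_at_comp f q); auto.
  - intros w _. assert (B : (f w - f z = p w * (w - z))%C) by (rewrite (Ef w); ring).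
    rewrite (Eg (f w)), B. ring.
Qed.

Lemma differentiable_inv z : z <> RtoC 0 -> differentiable Cinv z.
Proof.
  intros Hz. assert (P := proj1 (Cmod_gt_0 z) Hz).
  eexists. apply (caratheodory_diff_at _ z (fun w => / w * (- / z))%C (Cmod z)); auto.
  - apply cont_at_mult; [apply cont_at_inv; auto|apply cont_at_const].
  - intros w Hw. assert (w <> RtoC 0).
    { intros ->. replace (RtoC 0 - z)%C with (- z)%C in Hw by ring. rewrite Cmod_opp in Hw. lra. }
    field; auto.
Qed.

Lemma differentiable_inv_comp f z :
  f z <> RtoC 0 -> differentiable f z -> differentiable (fun w => / f w)%C z.
Proof. intros H1 H2. apply (differentiable_comp f Cinv); auto. now apply differentiable_inv. Qed.

Lemma differentiable_pow n z : differentiable (fun w => w ^ n)%C z.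
Proof.
  induction n as [|n IH].
  - exists (RtoC 0). apply (caratheodory_diff_at _ z (fun _ => RtoC 0) 1); [lra|apply cont_at_const|].
    intros w _. simpl. ring.
  - apply (differentiable_mult (fun w => w) (fun w => w ^ n)%C); auto.
    apply differentiable_id.
Qed.

(** * The exponential and polar coordinates *)

Definition circ (r t : R) : C := (r * cos t, r * sin t).

Definition cexp (w : C) : C := circ (exp (Re w)) (Im w).

Lemma circ_mult r s t u : (circ r t * circ s u)%C = circ (r * s) (t + u).
Proof.
  unfold circ. rewrite cos_plus, sin_plus. apply injective_projections; simpl; ring.
Qed.

Lemma Cmod_circ r t : 0 <= r -> Cmod (circ r t) = r.
Proof.
  intros Hr. unfold Cmod, circ. simpl fst; simpl snd.
  replace ((r * cos t) ^ 2 + (r * sin t) ^ 2) with (r * r * (Rsqr (sin t) + Rsqr (cos t))).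
  2:{ unfold Rsqr. ring. }
  rewrite sin2_cos2, Rmult_1_r. now apply sqrt_square.
Qed.

Lemma circ_pow r t n : (circ r t ^ n)%C = circ (r ^ n) (INR n * t).
Proof.
  induction n as [|n IH].
  - simpl. unfold circ. rewrite Rmult_0_l, cos_0, sin_0. apply injective_projections; simpl; ring.
  - rewrite Cpow_S, IH, circ_mult, S_INR. f_equal. ring.
Qed.

Lemma circ_inv r t : r <> 0 -> (/ circ r t)%C = circ (/ r) (- t).
Proof.
  intros Hr.
  assert (E : (circ r t * circ (/ r) (- t))%C = RtoC 1).
  { rewrite circ_mult. unfold circ. rewrite Rplus_opp_r, cos_0, sin_0, Rinv_r by auto.
    apply injective_projections; simpl; ring. }
  assert (N : circ r t <> RtoC 0).
  { intros Z. rewrite Z, Cmult_0_l in E. apply C1_nz. now symmetry. }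
  rewrite <- (Cmult_1_r (/ circ r t)), <- E, Cmult_assoc, Cinv_l, Cmult_1_l; auto.
Qed.

Lemma cexp_plus u v : cexp (u + v)%C = (cexp u * cexp v)%C.
Proof. unfold cexp. now rewrite circ_mult, <- exp_plus, re_plus, im_plus. Qed.

Lemma exp_first_order eps : 0 < eps -> exists d, 0 < d /\
  forall x, Rabs x < d -> Rabs (exp x - 1 - x) <= eps * Rabs x.
Proof.
  intros He. destruct (derivable_pt_lim_exp_0 eps He) as [d Hd].
  exists d. split; [apply cond_pos|]. intros x Hx.
  destruct (Req_dec x 0) as [->|nx].
  { rewrite exp_0. replace (1 - 1 - 0) with 0 by ring. rewrite Rabs_R0. lra. }
  specialize (Hd x nx Hx). rewrite exp_0, Rplus_0_l in Hd.
  replace (exp x - 1 - x) with (((exp x - 1) / x - 1) * x) by (field; auto).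
  rewrite Rabs_mult. apply Rmult_le_compat_r; [apply Rabs_pos|lra].
Qed.

Lemma sin_first_order eps : 0 < eps -> exists d, 0 < d /\
  forall x, Rabs x < d -> Rabs (sin x - x) <= eps * Rabs x.
Proof.
  intros He. destruct (derivable_pt_lim_sin_0 eps He) as [d Hd].
  exists d. split; [apply cond_pos|]. intros x Hx.
  destruct (Req_dec x 0) as [->|nx].
  { rewrite sin_0. replace (0 - 0) with 0 by ring. rewrite Rabs_R0. lra. }
  specialize (Hd x nx Hx). rewrite sin_0, Rplus_0_l in Hd.
  replace (sin x - x) with (((sin x - 0) / x - 1) * x) by (field; auto).
  rewrite Rabs_mult. apply Rmult_le_compat_r; [apply Rabs_pos|lra].
Qed.

Lemma cos_first_order eps : 0 < eps -> exists d, 0 < d /\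
  forall x, Rabs x < d -> Rabs (cos x - 1) <= eps * Rabs x.
Proof.
  intros He. destruct (derivable_pt_lim_cos_0 eps He) as [d Hd].
  exists d. split; [apply cond_pos|]. intros x Hx.
  destruct (Req_dec x 0) as [->|nx].
  { rewrite cos_0. replace (1 - 1) with 0 by ring. rewrite Rabs_R0. lra. }
  specialize (Hd x nx Hx). rewrite cos_0, Rplus_0_l in Hd.
  replace (cos x - 1) with (((cos x - 1) / x - 0) * x) by (field; auto).
  rewrite Rabs_mult. apply Rmult_le_compat_r; [apply Rabs_pos|lra].
Qed.

Lemma differentiable_cexp_0 : diff_at cexp (RtoC 0) (RtoC 1).
Proof.
  intros eps He.
  set (k := Rmin (eps / 10) 1).
  assert (Hk : 0 < k) by (apply Rmin_pos; lra).
  assert (Hk1 : k <= 1) by apply Rmin_r. assert (Hk2 : k <= eps / 10) by apply Rmin_l.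
  destruct (exp_first_order k Hk) as [d1 [p1 K1]].
  destruct (sin_first_order k Hk) as [d2 [p2 K2]].
  destruct (cos_first_order k Hk) as [d3 [p3 K3]].
  set (d := Rmin (Rmin d1 (Rmin d2 d3)) (k / 2)).
  assert (Hd : 0 < d) by (unfold d; repeat apply Rmin_pos; lra).
  exists d. split; auto. intros [x y] Hw.
  replace ((x, y) - RtoC 0)%C with ((x, y) : C) in * by (apply injective_projections; simpl; ring).
  assert (Hx : Rabs x <= Cmod (x, y)) by (apply (re_le_Cmod (x, y))).
  assert (Hy : Rabs y <= Cmod (x, y)) by (apply (im_le_Cmod (x, y))).
  set (m := Cmod (x, y)) in *.
  assert (D1 : d <= d1) by (unfold d; eapply Rle_trans; [apply Rmin_l|apply Rmin_l]).
  assert (D2 : d <= d2) by (unfold d; eapply Rle_trans; [apply Rmin_l|eapply Rle_trans; [apply Rmin_r|apply Rmin_l]]).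
  assert (D3 : d <= d3) by (unfold d; eapply Rle_trans; [apply Rmin_l|eapply Rle_trans; [apply Rmin_r|apply Rmin_r]]).
  assert (D4 : d <= k / 2) by (unfold d; apply Rmin_r).
  specialize (K1 x ltac:(lra)). specialize (K2 y ltac:(lra)). specialize (K3 y ltac:(lra)).
  assert (Ax := Rabs_pos x). assert (Ay := Rabs_pos y).
  assert (B1 : Rabs (exp x - 1) <= k).
  { replace (exp x - 1) with ((exp x - 1 - x) + x) by ring.
    eapply Rle_trans; [apply Rabs_triang|]. nra. }
  assert (B2 : Rabs (exp x) <= 2).
  { replace (exp x) with ((exp x - 1) + 1) by ring.
    eapply Rle_trans; [apply Rabs_triang|]. rewrite Rabs_R1. lra. }
  assert (R1 : Rabs (exp x * cos y - 1 - x) <= 3 * k * m).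
  { replace (exp x * cos y - 1 - x) with (exp x * (cos y - 1) + (exp x - 1 - x)) by ring.
    eapply Rle_trans; [apply Rabs_triang|]. rewrite Rabs_mult.
    assert (Rabs (exp x) * Rabs (cos y - 1) <= 2 * (k * m)).
    { apply Rmult_le_compat; try apply Rabs_pos; auto. eapply Rle_trans; [exact K3|]. nra. }
    nra. }
  assert (R2 : Rabs (exp x * sin y - y) <= 3 * k * m).
  { replace (exp x * sin y - y) with (exp x * (sin y - y) + (exp x - 1) * y) by ring.
    eapply Rle_trans; [apply Rabs_triang|]. rewrite !Rabs_mult.
    assert (Rabs (exp x) * Rabs (sin y - y) <= 2 * (k * m)).
    { apply Rmult_le_compat; try apply Rabs_pos; auto. eapply Rle_trans; [exact K2|]. nra. }
    assert (Rabs (exp x - 1) * Rabs y <= k * m) by (apply Rmult_le_compat; try apply Rabs_pos; auto).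
    nra. }
  assert (Hm : 0 <= m) by apply Cmod_ge_0.
  eapply Rle_trans; [apply Cmod_le_sum|].
  match goal with |- Rabs ?A + Rabs ?B <= _ =>
    replace A with (exp x * cos y - 1 - x); [replace B with (exp x * sin y - y)|] end.
  - nra.
  - unfold cexp, circ. simpl. rewrite sin_0. ring.
  - unfold cexp, circ. simpl. rewrite exp_0, cos_0. ring.
Qed.

(** The functional equation transports the derivative at [0] to any point. *)
Lemma differentiable_cexp w : differentiable cexp w.
Proof.
  destruct (diff_at_caratheodory _ _ _ differentiable_cexp_0) as [p [Cp [_ E]]].
  eexists. apply (caratheodory_diff_at _ w (fun z => cexp w * p (z - w))%C 1); [lra| |].
  - apply cont_at_mult; [apply cont_at_const|].
    apply (cont_at_comp (fun z => z - w)%C p).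
    + apply differentiable_cont, differentiable_affine.
    + replace (w - w)%C with (RtoC 0) by ring. exact Cp.
  - intros z _. replace z with (w + (z - w))%C at 1 by ring. rewrite cexp_plus, (E (z - w)%C).
    replace (cexp (RtoC 0)) with (RtoC 1). ring.
    unfold cexp, circ. simpl. rewrite exp_0, cos_0, sin_0. apply injective_projections; simpl; ring.
Qed.

Lemma polar (z : C) : exists t, 0 <= t < 2 * PI /\ z = circ (Cmod z) t.
Proof.
  assert (HP := PI_RGT_0).
  destruct (Ceq_dec z (RtoC 0)) as [->|nz].
  { exists 0. split; [lra|]. rewrite Cmod_0. unfold circ. apply injective_projections; simpl; ring. }
  assert (P := proj1 (Cmod_gt_0 z) nz). set (r := Cmod z) in *.
  destruct z as [x y].
  assert (Hr : r ^ 2 = x ^ 2 + y ^ 2) by (unfold r; rewrite Cmod2_alt; reflexivity).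
  assert (Hx : Rabs x <= r) by (apply (re_le_Cmod (x, y))).
  assert (Hb : -1 <= x / r <= 1).
  { apply Rabs_le_between in Hx.
    split; apply Rmult_le_reg_r with r; auto; unfold Rdiv; rewrite Rmult_assoc, Rinv_l; lra. }
  assert (Hs : sqrt (1 - (x / r)²) = Rabs y / r).
  { replace (1 - (x / r)²) with ((Rabs y / r)²).
    - apply sqrt_Rsqr. apply Rmult_le_pos; [apply Rabs_pos|]. left. now apply Rinv_0_lt_compat.
    - unfold Rsqr. replace (Rabs y / r * (Rabs y / r)) with (Rabs y ^ 2 / r ^ 2) by (field; lra).
      replace (x / r * (x / r)) with (x ^ 2 / r ^ 2) by (field; lra).
      rewrite pow2_abs. replace (y ^ 2) with (r ^ 2 - x ^ 2) by lra. field. lra. }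
  assert (Ha := acos_bound (x / r)).
  assert (Ec : cos (acos (x / r)) = x / r) by (apply cos_acos; lra).
  assert (Es : sin (acos (x / r)) = Rabs y / r) by (rewrite sin_acos by lra; exact Hs).
  destruct (Rle_dec 0 y) as [Hy|Hy].
  - exists (acos (x / r)). split; [lra|]. unfold circ. rewrite Ec, Es.
    rewrite Rabs_right by lra. apply injective_projections; simpl; field; lra.
  - exists (2 * PI - acos (x / r)). split.
    + split; [lra|]. destruct (Req_dec (acos (x / r)) 0) as [e|e]; [|lra].
      rewrite e, sin_0 in Es. assert (0 < Rabs y / r); [|lra].
      apply Rdiv_lt_0_compat; auto. apply Rabs_pos_lt; lra.
    + unfold circ.
      replace (2 * PI - acos (x / r)) with (- acos (x / r) + 2 * INR 1 * PI) by (simpl; ring).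
      rewrite cos_period, sin_period, cos_neg, sin_neg, Ec, Es.
      rewrite Rabs_left by lra. apply injective_projections; simpl; field; lra.
Qed.

(** This makes [cexp] injective on a rectangle of height [2 * PI] centred at the
    argument of a given point, so that the rectangle contains a single
    logarithm of that point. *)
Lemma cos_eq_1 t : - PI <= t <= PI -> cos t = 1 -> t = 0.
Proof.
  intros Ht Hc. assert (HP := PI_RGT_0).
  destruct (Rtotal_order t 0) as [h|[h|h]]; auto; exfalso.
  - rewrite <- cos_neg in Hc. assert (cos (- t) < cos 0); [|rewrite cos_0 in *; lra].
    apply cos_decreasing_1; lra.
  - assert (cos t < cos 0); [|rewrite cos_0 in *; lra]. apply cos_decreasing_1; lra.
Qed.

(** * Means over circles *)

(** The interval of integration can thus be centred at the argument of an
    exceptional point, away from the ends of the interval. *)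
Lemma CInt_period F c :
  (forall t, path_cont F t) -> (forall t, F (t + 2 * PI) = F t) ->
  CInt F c (c + 2 * PI) = CInt F 0 (2 * PI).
Proof.
  intros Hc Hp.
  assert (I : forall a b, is_CInt F a b (CInt F a b)) by (intros; apply path_cont_CInt; auto).
  apply is_CInt_unique.
  replace (CInt F 0 (2 * PI)) with (- CInt F 0 c + CInt F 0 (2 * PI) + CInt F 0 c)%C by ring.
  eapply is_CInt_Chasles; [eapply is_CInt_Chasles; [apply is_CInt_swap, I|apply I]|].
  replace (CInt F 0 c) with (CInt F (2 * PI) (c + 2 * PI)); [apply I|].
  symmetry. apply is_CInt_unique.
  destruct (I (2 * PI) (c + 2 * PI)) as [I1 I2].
  split.
  - apply is_RInt_ext with (fun y => scal 1 (Re (F (1 * y + 2 * PI)))).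
    { intros t _. change (1 * Re (F (1 * t + 2 * PI)) = Re (F t)). now rewrite !Rmult_1_l, Hp. }
    apply (is_RInt_comp_lin (V := R_NormedModule) (fun t => Re (F t))).
    rewrite Rmult_0_r, Rplus_0_l, Rmult_1_l. exact I1.
  - apply is_RInt_ext with (fun y => scal 1 (Im (F (1 * y + 2 * PI)))).
    { intros t _. change (1 * Im (F (1 * t + 2 * PI)) = Im (F t)). now rewrite !Rmult_1_l, Hp. }
    apply (is_RInt_comp_lin (V := R_NormedModule) (fun t => Im (F t))).
    rewrite Rmult_0_r, Rplus_0_l, Rmult_1_l. exact I2.
Qed.

Lemma circ_period r t : circ r (t + 2 * PI) = circ r t.
Proof.
  unfold circ. replace (t + 2 * PI) with (t + 2 * INR 1 * PI) by (simpl; ring).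
  now rewrite cos_period, sin_period.
Qed.

Lemma cexp_ln r t : 0 < r -> cexp (ln r, t) = circ r t.
Proof. intros. unfold cexp. simpl. now rewrite exp_ln. Qed.

Lemma path_cont_circ r t : 0 < r -> path_cont (circ r) t.
Proof.
  intros Hr. assert (P : path_cont (fun s => cexp (ln r, s)) t).
  { apply (cont_at_comp_path cexp (fun s => (ln r, s))); [apply path_cont_v|].
    apply differentiable_cont, differentiable_cexp. }
  intros eps He. destruct (P eps He) as [d [Hd K]]. exists d. split; auto.
  intros s Hs. rewrite <- !cexp_ln by auto. auto.
Qed.

Definition circ_int (G : C -> C) (r : R) : C := CInt (fun t => G (circ r t)) 0 (2 * PI).

Lemma is_CInt_circ G r : 0 < r -> (forall z, Cmod z = r -> cont_at G z) ->
  is_CInt (fun t => G (circ r t)) 0 (2 * PI) (circ_int G r).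
Proof.
  intros Hr Hc. apply path_cont_CInt. intros t _.
  apply (cont_at_comp_path G (circ r)). now apply path_cont_circ.
  apply Hc, Cmod_circ. lra.
Qed.

(** In the coordinate [w = log z] an annulus becomes a rectangle of height
    [2 PI] whose horizontal sides contribute opposite amounts, so Goursat's
    lemma says that the vertical sides, i.e. the circles, have equal means. *)
Lemma circ_int_const G z0 r1 r2 :
  0 < r1 -> r1 < r2 -> r2 < 1 -> Cmod z0 <> r1 -> Cmod z0 <> r2 ->
  (forall z, 0 < Cmod z < 1 -> cont_at G z) ->
  (forall z, 0 < Cmod z < 1 -> z <> z0 -> differentiable G z) ->
  circ_int G r1 = circ_int G r2.
Proof.
  intros h1 h2 h3 n1 n2 Hc Hd.
  assert (HP := PI_RGT_0).
  destruct (polar z0) as [v [_ Ev]]. set (m := Cmod z0) in *.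
  set (H := fun w => G (cexp w)).
  assert (Hm : forall x y, ln r1 <= x <= ln r2 -> 0 < Cmod (cexp (x, y)) < 1 /\ Cmod (cexp (x, y)) = exp x).
  { intros x y Hx. unfold cexp. simpl. assert (E := exp_pos x). rewrite Cmod_circ by lra.
    repeat split; auto. apply Rle_lt_trans with (exp (ln r2)); [|rewrite exp_ln; lra].
    destruct (Req_dec x (ln r2)) as [->|]; [lra|]. left. apply exp_increasing. lra. }
  assert (L : ln r1 < ln r2) by (apply ln_increasing; lra).
  assert (HcH : forall x y, ln r1 <= x <= ln r2 -> v - PI <= y <= v + PI -> cont_at H (x, y)).
  { intros x y Hx _. apply (cont_at_comp cexp G).
    apply differentiable_cont, differentiable_cexp. apply Hc. now apply Hm. }
  assert (Z : rect_int H (ln r1) (ln r2) (v - PI) (v + PI) = RtoC 0).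
  { destruct (classic (r1 < m < r2)) as [hm|hm].
    - apply (goursat_except H _ _ _ _ (ln m, v)); simpl; try lra; auto.
      { split; apply ln_increasing; lra. }
      intros x y Hx Hy ne. apply (differentiable_comp cexp G); [apply differentiable_cexp|].
      destruct (Hm x y Hx) as [g1 g2]. apply Hd; auto. intros e. apply ne.
      assert (ex : exp x = m) by (rewrite <- g2, e; reflexivity).
      assert (x = ln m) by (rewrite <- ex, ln_exp; auto). subst x. f_equal.
      rewrite cexp_ln, Ev in e by lra. unfold circ in e. injection e as e1 e2.
      apply Rmult_eq_reg_l in e1; [|lra]. apply Rmult_eq_reg_l in e2; [|lra].
      assert (y - v = 0); [|lra]. apply cos_eq_1; [lra|].
      rewrite cos_minus, e1, e2. assert (S := sin2_cos2 v). unfold Rsqr in S. lra.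
    - apply goursat; try lra. intros x y Hx Hy.
      apply (differentiable_comp cexp G); [apply differentiable_cexp|].
      destruct (Hm x y Hx) as [g1 g2]. apply Hd; auto. intros e.
      assert (ex : exp x = m) by (rewrite <- g2, e; reflexivity).
      apply hm. assert (r1 <= m <= r2); [|lra].
      rewrite <- ex. rewrite <- (exp_ln r1), <- (exp_ln r2) by lra.
      split; [destruct (proj1 Hx) as [q|q]|destruct (proj2 Hx) as [q|q]];
        solve [left; now apply exp_increasing | rewrite q; apply Rle_refl]. }
  rewrite (rect_int_eq H (ln r1) (ln r2) (v - PI) (v + PI) HcH) in Z by lra.
  assert (V : forall r, 0 < r -> r < 1 ->
    CInt (fun y => H (ln r, y)) (v - PI) (v + PI) = circ_int G r).
  { intros r g1 g2.
    unfold circ_int. rewrite <- (CInt_period (fun t => G (circ r t)) (v - PI)).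
    - replace (v - PI + 2 * PI) with (v + PI) by ring.
      unfold CInt, H. f_equal; apply RInt_ext; intros t _; now rewrite cexp_ln.
    - intros t. apply (cont_at_comp_path G (circ r)); [now apply path_cont_circ|].
      apply Hc. rewrite Cmod_circ; lra.
    - intros t. now rewrite circ_period. }
  rewrite !V in Z by lra.
  replace (CInt (fun x => H (x, v + PI)) (ln r1) (ln r2))
    with (CInt (fun x => H (x, v - PI)) (ln r1) (ln r2)) in Z.
  2:{ unfold CInt, H. f_equal; apply RInt_ext; intros t _; unfold cexp; simpl;
      replace (v + PI) with (v - PI + 2 * PI) by ring; now rewrite circ_period. }
  assert (Z' : (Ci * (circ_int G r2 - circ_int G r1))%C = RtoC 0).
  { rewrite <- Z. ring. }
  symmetry. apply Ceq_minus.
  rewrite <- (Cmult_1_l (_ - _)), <- (Cinv_l Ci Ci_nz), <- Cmult_assoc, Z'. ring.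
Qed.

Lemma is_CInt_circ_mult r k :
  k <> 0 -> cos (2 * PI * k) = 1 -> sin (2 * PI * k) = 0 ->
  is_CInt (fun t => circ r (k * t)) 0 (2 * PI) (RtoC 0).
Proof.
  intros Hk Hc Hs. split; simpl.
  - assert (D : is_RInt (fun t => r * cos (k * t)) 0 (2 * PI)
       (minus (r * sin (k * (2 * PI)) / k) (r * sin (k * 0) / k))).
    { apply (is_RInt_derive (V := R_CompleteNormedModule) (fun t => r * sin (k * t) / k)).
      - intros x _. auto_derive; auto. field; auto.
      - intros x _. apply (ex_derive_continuous (V := R_NormedModule)). auto_derive; auto. }
    replace (minus _ _) with 0 in D; [exact D|].
    rewrite (Rmult_comm k (2 * PI)), Hs, !Rmult_0_r, sin_0. unfold minus, plus, opp; simpl. field; auto.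
  - assert (D : is_RInt (fun t => r * sin (k * t)) 0 (2 * PI)
       (minus (- r * cos (k * (2 * PI)) / k) (- r * cos (k * 0) / k))).
    { apply (is_RInt_derive (V := R_CompleteNormedModule) (fun t => - r * cos (k * t) / k)).
      - intros x _. auto_derive; auto. field; auto.
      - intros x _. apply (ex_derive_continuous (V := R_NormedModule)). auto_derive; auto. }
    replace (minus _ _) with 0 in D; [exact D|].
    rewrite (Rmult_comm k (2 * PI)), Hc, !Rmult_0_r, cos_0. unfold minus, plus, opp; simpl. field; auto.
Qed.

Lemma cos_sin_2PI_nat n : cos (2 * PI * INR n) = 1 /\ sin (2 * PI * INR n) = 0.
Proof.
  replace (2 * PI * INR n) with (0 + 2 * INR n * PI) by ring.
  rewrite cos_period, sin_period. split; [apply cos_0|apply sin_0].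
Qed.

Lemma is_CInt_circ_pow r n :
  (0 < n)%nat -> is_CInt (fun t => circ r t ^ n)%C 0 (2 * PI) (RtoC 0).
Proof.
  intros Hn. destruct (cos_sin_2PI_nat n) as [E1 E2].
  eapply is_CInt_ext; [intros t _; symmetry; apply circ_pow|].
  apply is_CInt_circ_mult; auto. apply not_0_INR. lia.
Qed.

Lemma is_CInt_circ_inv_pow r n :
  r <> 0 -> (0 < n)%nat -> is_CInt (fun t => / circ r t ^ n)%C 0 (2 * PI) (RtoC 0).
Proof.
  intros Hr Hn. destruct (cos_sin_2PI_nat n) as [E1 E2].
  apply is_CInt_ext with (fun t => circ (/ r ^ n) (- INR n * t)).
  { intros t _. rewrite circ_pow, circ_inv by (now apply pow_nonzero).
    now rewrite Ropp_mult_distr_l. }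
  apply is_CInt_circ_mult.
  - apply Ropp_neq_0_compat, not_0_INR. lia.
  - replace (2 * PI * - INR n) with (- (2 * PI * INR n)) by ring. now rewrite cos_neg.
  - replace (2 * PI * - INR n) with (- (2 * PI * INR n)) by ring. rewrite sin_neg, E2. ring.
Qed.

(** * Series of complex numbers *)

Definition clim (u : nat -> C) (l : C) : Prop :=
  forall eps, 0 < eps -> exists N, forall n, (N <= n)%nat -> Cmod (u n - l)%C < eps.

Definition csum (a : nat -> C) (n : nat) : C := @sum_n C_NormedModule a n.

Lemma is_series_C (a : nat -> C) (l : C) :
  @is_series C_AbsRing C_NormedModule a l <->
  clim (csum a) l.
Proof.
  unfold is_series. split.
  - intros H eps He.
    assert (He2 : 0 < eps / 2) by lra.
    assert (L := proj1 (filterlim_locally (F := eventually) _ l) H (mkposreal _ He2)).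
    destruct L as [N HN]. exists N. intros n Hn. destruct (HN n Hn) as [B1 B2].
    eapply Rle_lt_trans; [apply Cmod_le_sum|].
    change (Rabs (fst (csum a n) + - fst l) < eps / 2) in B1.
    change (Rabs (snd (csum a n) + - snd l) < eps / 2) in B2.
    change (Rabs (fst (csum a n) + - fst l)
      + Rabs (snd (csum a n) + - snd l) < eps). lra.
  - intros H. apply filterlim_locally. intros eps.
    destruct (H eps (cond_pos eps)) as [N HN]. exists N. intros n Hn.
    apply (C_NormedModule_mixin_compat1 l). apply HN, Hn.
Qed.

Lemma csum_S (a : nat -> C) n :
  csum a (S n) = (csum a n + a (S n))%C.
Proof. apply (sum_Sn (G := C_NormedModule)). Qed.

Lemma csum_O (a : nat -> C) : csum a 0 = a O.
Proof. apply (sum_O (G := C_NormedModule)). Qed.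

Lemma csum_scal c (a : nat -> C) n : (c * csum a n)%C = csum (fun k => c * a k)%C n.
Proof.
  induction n as [|n IH]; [now rewrite !csum_O|]. rewrite !csum_S, <- IH. ring.
Qed.

Lemma csum_ext (a b : nat -> C) n : (forall k, (k <= n)%nat -> a k = b k) -> csum a n = csum b n.
Proof.
  intros E. induction n as [|n IH]; [rewrite !csum_O; auto|]. rewrite !csum_S, IH, E; auto.
Qed.

Lemma is_CInt_csum (F : nat -> R -> C) a b (l : nat -> C) n :
  (forall k, is_CInt (F k) a b (l k)) ->
  is_CInt (fun t => csum (fun k => F k t) n) a b (csum l n).
Proof.
  intros HF. induction n as [|n IH].
  - apply is_CInt_ext with (F O). { intros t _. now rewrite csum_O. } rewrite csum_O. apply HF.
  - apply is_CInt_ext with (fun t => csum (fun k => F k t) n + F (S n) t)%C.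
    { intros t _. now rewrite csum_S. } rewrite csum_S. now apply is_CInt_plus.
Qed.

Lemma pow_n_Cpow (z : C) n : @pow_n C_AbsRing z n = (z ^ n)%C.
Proof. induction n as [|n IH]; [reflexivity|]. simpl. rewrite IH. reflexivity. Qed.

Definition psum (a : nat -> C) (z : C) (n : nat) : C :=
  csum (fun k => z ^ k * a k)%C n.

Lemma psum_S a z n : psum a z (S n) = (psum a z n + z ^ S n * a (S n))%C.
Proof. apply csum_S. Qed.

Lemma psum_O a z : psum a z 0 = a O.
Proof. unfold psum. rewrite csum_O. simpl. ring. Qed.

Lemma is_pseries_C a z l :
  @is_pseries C_AbsRing C_NormedModule a z l <->
  clim (psum a z) l.
Proof.
  unfold is_pseries. rewrite is_series_C.
  assert (E : forall n, csum (fun k => @scal C_AbsRing C_NormedModule (@pow_n C_AbsRing z k) (a k)) n = psum a z n).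
  { intros n. apply sum_n_ext. intros k. now rewrite pow_n_Cpow. }
  split; intros H eps He; destruct (H eps He) as [N HN]; exists N; intros n Hn;
    specialize (HN n Hn); rewrite E in *; exact HN.
Qed.

Lemma is_derive_diff_at f (z l : C) :
  @is_derive C_AbsRing C_NormedModule f z l <-> diff_at f z l.
Proof.
  split.
  - intros [_ H] eps He.
    specialize (H z (fun P HP => HP) (mkposreal eps He)).
    destruct H as [d Hd]. exists d. split; [apply cond_pos|]. intros w Hw.
    specialize (Hd w Hw). simpl in Hd.
    replace (f w - f z - l * (w - z))%C with (f w - f z - (w - z) * l)%C by ring. exact Hd.
  - intros H. split.
    + apply (is_linear_scal_l (K := C_AbsRing) (V := C_NormedModule)).
    + intros x Hx eps.
      assert (x = z) by (symmetry; exact (is_filter_lim_locally_unique (K := C_AbsRing) (V := AbsRing_NormedModule C_AbsRing) z x Hx)).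
      subst x. destruct (H eps (cond_pos eps)) as [d [Hd K]].
      exists (mkposreal d Hd). intros w Hw. specialize (K w Hw).
      replace (f w - f z - l * (w - z))%C with (f w - f z - (w - z) * l)%C in K by ring. exact K.
Qed.

Lemma analytic_iff f : analytic f <-> forall z, Cmod z < 1 -> differentiable f z.
Proof.
  split; intros H z Hz; destruct (H z Hz) as [l Hl]; exists l; now apply is_derive_diff_at.
Qed.

Lemma pow_small q : 0 <= q < 1 -> forall B eps, 0 < eps ->
  exists N, forall n, (N <= n)%nat -> B * q ^ n < eps.
Proof.
  intros Hq B eps He. assert (P := Rabs_pos B).
  destruct (pow_lt_1_zero q ltac:(rewrite Rabs_right; lra) (eps / (Rabs B + 1))) as [N HN].
  { apply Rdiv_lt_0_compat; lra. }
  exists N. intros n Hn. specialize (HN n Hn).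
  rewrite Rabs_right in HN by (apply Rle_ge, pow_le; lra).
  apply (Rmult_lt_compat_r (Rabs B + 1)) in HN; [|lra].
  replace (eps / (Rabs B + 1) * (Rabs B + 1)) with eps in HN by (field; lra).
  assert (H := Rle_abs B). assert (H' : 0 <= q ^ n) by (apply pow_le; lra). nra.
Qed.

(** * Taylor expansion *)

(** The geometric sum of the powers of [z0 / z] is multiplied by
    [fz = f0 + p (z - z0)], and the part with [p] telescopes. On a circle around
    [0] of radius larger than [|z0|], the sum multiplying [f0] has mean [1],
    since negative powers of [z] have mean zero, and the last term is
    geometrically small. *)
Lemma laurent_telescope (f0 p z z0 fz : C) N :
  z <> RtoC 0 -> fz = (f0 + p * (z - z0))%C ->
  csum (fun n => z0 ^ n * (fz * / z ^ n))%C N =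
  (f0 * csum (fun n => z0 ^ n * / z ^ n)%C N + z * p - z0 ^ S N * p * / z ^ N)%C.
Proof.
  intros Hz E. subst fz. induction N as [|N IH].
  - rewrite !csum_O. simpl. replace (/ RtoC 1)%C with (RtoC 1) by field. ring.
  - rewrite !csum_S, IH, !Cpow_S. field. split; auto. now apply Cpow_nz.
Qed.

Section Taylor.
Variables (f : C -> C) (M : R).
Hypothesis Hd : forall z, Cmod z < 1 -> differentiable f z.
Hypothesis HM : forall z, Cmod z < 1 -> Cmod (f z) <= M.

(** The mean of [f z / z^n] over the circle of radius [1/2], a choice that is
    immaterial by [taylor_coeff_eq]. *)
Definition taylor_coeff (n : nat) : C :=
  (/ RtoC (2 * PI) * circ_int (fun z => f z * / z ^ n) (1 / 2))%C.

Lemma two_PI_neq_0 : RtoC (2 * PI) <> RtoC 0.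
Proof. intros E. apply RtoC_inj in E. assert (H := PI_RGT_0). lra. Qed.

Lemma differentiable_over_pow n z :
  0 < Cmod z < 1 -> differentiable (fun z => f z * / z ^ n)%C z.
Proof.
  intros Hz. apply differentiable_mult; [apply Hd; lra|].
  apply differentiable_inv_comp; [|apply differentiable_pow].
  apply Cpow_nz. apply Cmod_gt_0. lra.
Qed.

Lemma taylor_coeff_eq n r :
  0 < r < 1 -> circ_int (fun z => f z * / z ^ n)%C r = (RtoC (2 * PI) * taylor_coeff n)%C.
Proof.
  intros Hr. unfold taylor_coeff. rewrite Cmult_assoc, Cinv_r, Cmult_1_l by apply two_PI_neq_0.
  destruct (Rtotal_order r (1 / 2)) as [h|[h|h]].
  - apply circ_int_const with (z0 := RtoC 0); rewrite ?Cmod_0; try lra; intros;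
      try apply differentiable_cont; now apply differentiable_over_pow.
  - now rewrite h.
  - symmetry. apply circ_int_const with (z0 := RtoC 0); rewrite ?Cmod_0; try lra; intros;
      try apply differentiable_cont; now apply differentiable_over_pow.
Qed.

(** The mean is independent of the radius and tends to [0] with the radius:
    [z * phi z] has no residue although [phi] may fail to be differentiable
    at [z0]. *)
Lemma circ_int_quotient phi z0 r :
  Cmod z0 < r < 1 ->
  (forall z, Cmod z < 1 -> cont_at phi z) ->
  (forall z, Cmod z < 1 -> z <> z0 -> differentiable phi z) ->
  circ_int (fun z => z * phi z)%C r = RtoC 0.
Proof.
  intros Hr Hc Hp. assert (P0 := Cmod_ge_0 z0). assert (HP := PI_RGT_0).
  set (G := fun z => (z * phi z)%C).
  assert (Gc : forall z, Cmod z < 1 -> cont_at G z).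
  { intros z Hz. apply cont_at_mult; [apply cont_at_id|auto]. }
  apply Cmod_eq_0. apply Rle_antisym; [|apply Cmod_ge_0]. apply Rnot_lt_le. intros Hpos.
  set (m := Cmod (circ_int G r)) in *.
  set (K := Cmod (phi (RtoC 0)) + 1).
  assert (HK : 0 < K) by (assert (h := Cmod_ge_0 (phi (RtoC 0))); unfold K; lra).
  destruct (Hc (RtoC 0) ltac:(rewrite Cmod_0; lra) 1 Rlt_0_1) as [d [Hdl K1]].
  (* The radius [t / 2] has to be small compared with [m] and different from
     [|z0|], the exceptional radius; the latter is only a constraint when
     [z0] is not [0], for the value [0] is never a radius. *)
  set (s := if Req_dec_T (Cmod z0) 0 then 1 else Cmod z0).
  assert (Hs : 0 < s) by (unfold s; destruct (Req_dec_T (Cmod z0) 0); lra).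
  set (t := Rmin (Rmin d s) (Rmin r (m / (2 * PI * K)))).
  assert (Ht : 0 < t).
  { unfold t. repeat apply Rmin_pos; try lra. apply Rdiv_lt_0_compat; auto. nra. }
  assert (t1 : t <= d) by (eapply Rle_trans; [apply Rmin_l|apply Rmin_l]).
  assert (t2 : t <= s) by (eapply Rle_trans; [apply Rmin_l|apply Rmin_r]).
  assert (t3 : t <= r) by (eapply Rle_trans; [apply Rmin_r|apply Rmin_l]).
  assert (t4 : t <= m / (2 * PI * K)) by (eapply Rle_trans; [apply Rmin_r|apply Rmin_r]).
  assert (n1 : Cmod z0 <> t / 2).
  { unfold s in t2. destruct (Req_dec_T (Cmod z0) 0); lra. }
  assert (E : circ_int G (t / 2) = circ_int G r).
  { apply circ_int_const with (z0 := z0); try lra.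
    - intros z Hz. apply Gc. lra.
    - intros z Hz ne. apply (differentiable_mult (fun z => z) phi).
      + apply differentiable_id.
      + apply Hp; auto. lra. }
  assert (B : m <= (2 * PI - 0) * (t / 2 * K)).
  { unfold m. rewrite <- E.
    apply (is_CInt_le_const (fun a => G (circ (t / 2) a)) 0 (2 * PI)); [lra| |].
    2:{ apply is_CInt_circ; [lra|]. intros z Hz. apply Gc. lra. }
    intros a _. unfold G. rewrite Cmod_mult, Cmod_circ by lra.
    apply Rmult_le_compat_l; [lra|].
    set (z := circ (t / 2) a).
    assert (Hz : Cmod (z - RtoC 0)%C < d).
    { replace (z - RtoC 0)%C with z by ring. unfold z. rewrite Cmod_circ; lra. }
    specialize (K1 z Hz). assert (T := Cmod_triangle_rev (phi z) (phi (RtoC 0))).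
    unfold K. lra. }
  assert (t * (2 * PI * K) <= m).
  { apply (Rmult_le_compat_r (2 * PI * K)) in t4; [|nra].
    replace (m / (2 * PI * K) * (2 * PI * K)) with m in t4 by (field; lra). exact t4. }
  lra.
Qed.

(** Averaging [laurent_telescope] over the circle of radius [r]. *)
Lemma taylor_remainder z0 r N :
  Cmod z0 < r < 1 ->
  Cmod (f z0 - psum taylor_coeff z0 N)%C <=
    (Cmod z0 * (2 * M / (r - Cmod z0))) * (Cmod z0 / r) ^ N.
Proof.
  intros Hr. assert (P0 := Cmod_ge_0 z0). assert (HP := PI_RGT_0).
  assert (Hz0 : Cmod z0 < 1) by lra.
  destruct (Hd z0 Hz0) as [l Hl].
  destruct (diff_at_caratheodory _ _ _ Hl) as [phi [Cphi [_ E]]].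
  assert (Dphi : forall z, Cmod z < 1 -> z <> z0 -> differentiable phi z).
  { intros z Hz ne.
    assert (Q : 0 < Cmod (z - z0)%C) by (apply Cmod_gt_0, Cminus_eq_contra; auto).
    apply differentiable_ext_loc with (f := fun w => ((f w - f z0) * / (w - z0))%C) (d := Cmod (z - z0)%C); auto.
    - intros w Hw.
      assert (w <> z0).
      { intros ->. rewrite Cmod_minus_sym in Hw. lra. }
      rewrite (E w). field. now apply Cminus_eq_contra.
    - apply differentiable_mult.
      + apply differentiable_minus_const. auto.
      + apply differentiable_inv_comp; [now apply Cminus_eq_contra|apply differentiable_affine]. }
  assert (Cphi' : forall z, Cmod z < 1 -> cont_at phi z).
  { intros z Hz. destruct (Ceq_dec z z0) as [->|ne]; auto. apply differentiable_cont; auto. }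
  assert (I0 := circ_int_quotient phi z0 r Hr Cphi' Dphi).
  assert (I1 : is_CInt (fun t => circ r t * phi (circ r t))%C 0 (2 * PI) (RtoC 0)).
  { rewrite <- I0. apply (is_CInt_circ (fun z => z * phi z)%C); [lra|].
    intros z Hz. apply cont_at_mult; [apply cont_at_id|]. apply Cphi'. lra. }
  assert (I2 : is_CInt (fun t => csum (fun n => z0 ^ n * (f (circ r t) * / circ r t ^ n))%C N)
     0 (2 * PI) (RtoC (2 * PI) * psum taylor_coeff z0 N)%C).
  { assert (I : forall n, is_CInt (fun t => z0 ^ n * (f (circ r t) * / circ r t ^ n))%C 0 (2 * PI)
      (RtoC (2 * PI) * (z0 ^ n * taylor_coeff n))%C).
    { intros n. replace (RtoC (2 * PI) * (z0 ^ n * taylor_coeff n))%C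
        with (z0 ^ n * (RtoC (2 * PI) * taylor_coeff n))%C by ring.
      rewrite <- (taylor_coeff_eq n r) by lra. apply is_CInt_scal.
      apply (is_CInt_circ (fun z => f z * / z ^ n)%C); [lra|]. intros z Hz.
      apply differentiable_cont, differentiable_over_pow. lra. }
    unfold psum. rewrite csum_scal. now apply is_CInt_csum. }
  assert (I3 : is_CInt (fun t => csum (fun n => z0 ^ n * / circ r t ^ n)%C N) 0 (2 * PI) (RtoC (2 * PI))).
  { clear I2. induction N as [|N IH].
    - apply is_CInt_ext with (f := fun _ => RtoC 1).
      { intros t _. rewrite csum_O. simpl. rewrite Cmult_1_l.
        rewrite <- (Cinv_l (RtoC 1) C1_nz) at 1. ring. }
      replace (RtoC (2 * PI)) with (RtoC (2 * PI - 0) * RtoC 1)%C. apply is_CInt_const.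
      rewrite Rminus_0_r. ring.
    - apply is_CInt_ext with
        (f := fun t => (csum (fun n => z0 ^ n * / circ r t ^ n)%C N + z0 ^ S N * / circ r t ^ S N)%C).
      { intros t _. now rewrite csum_S. }
      replace (RtoC (2 * PI)) with (RtoC (2 * PI) + z0 ^ S N * RtoC 0)%C by ring.
      apply is_CInt_plus; [exact IH|]. apply is_CInt_scal. apply is_CInt_circ_inv_pow; [lra|lia]. }
  assert (I4 := is_CInt_minus _ _ _ _ _ _ (is_CInt_plus _ _ _ _ _ _ (is_CInt_scal _ _ _ _ (f z0) I3) I1) I2).
  apply is_CInt_le_const with (M := Cmod z0 * (2 * M / (r - Cmod z0)) * (Cmod z0 / r) ^ N) in I4; [|lra|].
  - replace (f z0 * RtoC (2 * PI) + RtoC 0 - RtoC (2 * PI) * psum taylor_coeff z0 N)%C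
      with (RtoC (2 * PI) * (f z0 - psum taylor_coeff z0 N))%C in I4 by ring.
    rewrite Cmod_mult, Cmod_R, Rabs_right, Rminus_0_r in I4 by lra.
    apply Rmult_le_reg_l in I4; [exact I4|lra].
  - intros t _. set (z := circ r t).
    assert (Hz : Cmod z = r) by (apply Cmod_circ; lra).
    assert (nz : z <> RtoC 0) by (apply Cmod_gt_0; lra).
    rewrite (laurent_telescope (f z0) (phi z) z z0 (f z) N nz (E z)).
    match goal with |- Cmod ?u <= _ => replace u with (z0 ^ S N * (phi z * / z ^ N))%C by ring end.
    rewrite !Cmod_mult, Cmod_inv, !Cmod_pow, Hz by (now apply Cpow_nz).
    unfold Rdiv. rewrite Rpow_mult_distr, pow_inv.
    assert (B : Cmod (phi z) <= 2 * M * / (r - Cmod z0)).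
    { apply Rmult_le_reg_r with (r - Cmod z0); [lra|]. rewrite Rmult_assoc, Rinv_l, Rmult_1_r by lra.
      assert (T := Cmod_triangle_rev z z0). rewrite Hz in T.
      apply Rle_trans with (Cmod (phi z) * Cmod (z - z0)%C).
      { apply Rmult_le_compat_l; [apply Cmod_ge_0|lra]. }
      rewrite <- Cmod_mult. replace (phi z * (z - z0))%C with (f z - f z0)%C by (rewrite (E z); ring).
      eapply Rle_trans; [apply Cmod_minus_triangle|].
      assert (h1 := HM z ltac:(lra)). assert (h2 := HM z0 Hz0). lra. }
    simpl pow.
    assert (Q : 0 <= Cmod z0 ^ N) by (now apply pow_le).
    assert (Q' : 0 < / r ^ N) by (apply Rinv_0_lt_compat, pow_lt; lra).
    replace (Cmod z0 * Cmod z0 ^ N * (Cmod (phi z) * / r ^ N))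
      with (Cmod z0 * Cmod z0 ^ N * / r ^ N * Cmod (phi z)) by ring.
    replace (Cmod z0 * (2 * M * / (r - Cmod z0)) * (Cmod z0 ^ N * / r ^ N))
      with (Cmod z0 * Cmod z0 ^ N * / r ^ N * (2 * M * / (r - Cmod z0))) by ring.
    apply Rmult_le_compat_l; [|exact B]. apply Rmult_le_pos; [|lra]. now apply Rmult_le_pos.
Qed.

Lemma taylor_expansion : expansion taylor_coeff f.
Proof.
  intros z Hz. unfold unit_disk in Hz. apply is_pseries_C. intros eps He.
  assert (P0 := Cmod_ge_0 z). set (r := (Cmod z + 1) / 2).
  assert (Hr : Cmod z < r < 1) by (unfold r; lra).
  destruct (pow_small (Cmod z / r)) with (B := Cmod z * (2 * M / (r - Cmod z))) (eps := eps) as [N HN]; auto.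
  { split. { apply Rmult_le_pos; auto. left. apply Rinv_0_lt_compat. lra. }
    apply Rmult_lt_reg_r with r; [lra|]. unfold Rdiv. rewrite Rmult_assoc, Rinv_l; lra. }
  exists N. intros n Hn. rewrite Cmod_minus_sym.
  eapply Rle_lt_trans; [apply taylor_remainder; eassumption|auto].
Qed.
End Taylor.

(** * Limits of complex sequences *)

Lemma clim_le u l B N0 : (forall n, (N0 <= n)%nat -> Cmod (u n) <= B) -> clim u l -> Cmod l <= B.
Proof.
  intros HB Hl. apply Rnot_lt_le. intros h.
  destruct (Hl (Cmod l - B)) as [N HN]; [lra|].
  specialize (HN (Nat.max N N0) ltac:(lia)). specialize (HB (Nat.max N N0) ltac:(lia)).
  rewrite Cmod_minus_sym in HN. assert (T := Cmod_triangle_rev l (u (Nat.max N N0))). lra.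
Qed.

Lemma clim_minus_const u l c : clim u l -> clim (fun n => u n - c)%C (l - c)%C.
Proof.
  intros H eps He. destruct (H eps He) as [N HN]. exists N. intros n Hn.
  replace (u n - c - (l - c))%C with (u n - l)%C by ring. auto.
Qed.

Lemma clim_plus u v l m : clim u l -> clim v m -> clim (fun n => u n + v n)%C (l + m)%C.
Proof.
  intros Hu Hv eps He. destruct (Hu (eps / 2) ltac:(lra)) as [N1 H1].
  destruct (Hv (eps / 2) ltac:(lra)) as [N2 H2]. exists (Nat.max N1 N2). intros n Hn.
  specialize (H1 n ltac:(lia)). specialize (H2 n ltac:(lia)).
  replace (u n + v n - (l + m))%C with ((u n - l) + (v n - m))%C by ring.
  eapply Rle_lt_trans; [apply Cmod_triangle|lra].
Qed.

Lemma clim_scal c u l : clim u l -> clim (fun n => c * u n)%C (c * l)%C.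
Proof.
  intros Hu eps He. assert (P := Cmod_ge_0 c).
  destruct (Hu (eps / (Cmod c + 1))) as [N HN]. { apply Rdiv_lt_0_compat; lra. }
  exists N. intros n Hn. specialize (HN n Hn).
  replace (c * u n - c * l)%C with (c * (u n - l))%C by ring. rewrite Cmod_mult.
  assert (Q := Cmod_ge_0 (u n - l)%C).
  apply (Rmult_lt_compat_r (Cmod c + 1)) in HN; [|lra].
  replace (eps / (Cmod c + 1) * (Cmod c + 1)) with eps in HN by (field; lra). nra.
Qed.

Lemma clim_ext u v l : (forall n, u n = v n) -> clim u l -> clim v l.
Proof. intros E H eps He. destruct (H eps He) as [N HN]. exists N. intros. rewrite <- E. auto. Qed.

Lemma clim_csum (u : nat -> nat -> C) l m :
  (forall n, clim (u n) (l n)) -> clim (fun k => csum (fun n => u n k) m) (csum l m).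
Proof.
  intros H. induction m as [|m IH].
  - apply clim_ext with (u O). { intros n. now rewrite csum_O. } rewrite csum_O. apply H.
  - apply clim_ext with (fun k => csum (fun n => u n k) m + u (S m) k)%C.
    { intros n. now rewrite csum_S. } rewrite csum_S. now apply clim_plus.
Qed.

Lemma Cmod_csum_le a n : Cmod (csum a n) <= sum_f_R0 (fun k => Cmod (a k)) n.
Proof.
  induction n as [|n IH].
  - rewrite csum_O. simpl. lra.
  - rewrite csum_S. simpl. eapply Rle_trans; [apply Cmod_triangle|lra].
Qed.

Lemma sum_nonneg u n : (forall k, 0 <= u k) -> 0 <= sum_f_R0 u n.
Proof. intros. now apply cond_pos_sum. Qed.

Lemma ex_series_bounded (v : nat -> R) V :
  (forall k, 0 <= v k) -> (forall n, sum_f_R0 v n <= V) -> ex_series v.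
Proof.
  intros Hv HV.
  destruct (ex_finite_lim_seq_incr (sum_n v) V) as [l Hl].
  - intros n. rewrite sum_Sn. change (plus (sum_n v n) (v (S n))) with (sum_n v n + v (S n)).
    specialize (Hv (S n)). lra.
  - intros n. rewrite sum_n_Reals. apply HV.
  - exists l. exact Hl.
Qed.

Lemma dominated_clim u v V :
  (forall k, Cmod (u k) <= v k) -> (forall n, sum_f_R0 v n <= V) ->
  exists l, clim (csum u) l.
Proof.
  intros Hu HV.
  assert (S := ex_series_bounded v V (fun k => Rle_trans _ _ _ (Cmod_ge_0 _) (Hu k)) HV).
  destruct (@ex_series_le C_AbsRing C_CompleteNormedModule u v Hu S) as [l Hl].
  exists l. exact (proj1 (is_series_C u l) Hl).
Qed.

(** * Coefficient estimates *)

Section Coefficients.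
Variables (a : nat -> C) (f : C -> C).
Hypothesis Hexp : expansion a f.

Lemma expansion_clim z : Cmod z < 1 -> clim (psum a z) (f z).
Proof. intros Hz. apply is_pseries_C. now apply Hexp. Qed.

Lemma coeff_growth s : 0 <= s < 1 -> exists B, forall k, s ^ k * Cmod (a k) <= B.
Proof.
  intros Hs.
  assert (Hz : Cmod (RtoC s) < 1) by (rewrite Cmod_R, Rabs_right; lra).
  destruct (filterlim_bounded (K := C_AbsRing) (V := C_NormedModule) (psum a (RtoC s))) as [B HB].
  { exists (f (RtoC s)). apply filterlim_locally. intros eps.
    destruct (expansion_clim _ Hz eps (cond_pos eps)) as [N HN]. exists N. intros n Hn.
    apply (C_NormedModule_mixin_compat1 (f (RtoC s))). apply HN, Hn. }
  assert (HB' : forall n, Cmod (psum a (RtoC s) n) <= B) by exact HB.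
  exists (2 * B). intros k.
  replace (s ^ k * Cmod (a k)) with (Cmod (RtoC s ^ k * a k)%C).
  2:{ now rewrite Cmod_mult, Cmod_pow, Cmod_R, Rabs_right by lra. }
  destruct k as [|k].
  - replace (RtoC s ^ 0 * a O)%C with (psum a (RtoC s) 0) by (rewrite psum_O; simpl; ring).
    assert (h := HB' O). assert (h' := Cmod_ge_0 (psum a (RtoC s) 0)). lra.
  - replace (RtoC s ^ S k * a (S k))%C with (psum a (RtoC s) (S k) - psum a (RtoC s) k)%C
      by (rewrite psum_S; ring).
    eapply Rle_trans; [apply Cmod_minus_triangle|].
    assert (h := HB' k). assert (h' := HB' (S k)). lra.
Qed.

(** The terms are dominated by a geometric series of ratio [r / s] with
    [r < s < 1]. *)
Lemma psum_uniform r eps : 0 <= r < 1 -> 0 < eps ->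
  exists N, forall n z, (N <= n)%nat -> Cmod z <= r -> Cmod (psum a z n - f z)%C <= eps.
Proof.
  intros Hr He. set (s := (1 + r) / 2). assert (Hs : r < s < 1) by (unfold s; lra).
  destruct (coeff_growth s ltac:(lra)) as [B HB].
  assert (B0 : 0 <= B). { eapply Rle_trans; [|apply (HB O)]. simpl. assert (h := Cmod_ge_0 (a O)). lra. }
  set (q := r / s).
  assert (Eq : q * s = r) by (unfold q; field; lra).
  assert (Hq : 0 <= q < 1).
  { split. { unfold q. apply Rmult_le_pos; [lra|]. left. apply Rinv_0_lt_compat. lra. } nra. }
  destruct (pow_small q Hq (B / (1 - q)) eps He) as [N HN].
  exists N. intros n z Hn Hz.
  assert (T : forall k, Cmod (z ^ k * a k)%C <= B * q ^ k).
  { intros k. rewrite Cmod_mult, Cmod_pow.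
    apply Rle_trans with (r ^ k * Cmod (a k)).
    { apply Rmult_le_compat_r; [apply Cmod_ge_0|]. apply pow_incr. split; [apply Cmod_ge_0|auto]. }
    rewrite <- Eq, Rpow_mult_distr. rewrite Rmult_assoc, (Rmult_comm B).
    apply Rmult_le_compat_l; [apply pow_le; lra|apply HB]. }
  assert (D : forall k, Cmod (psum a z (n + k) - psum a z n)%C <= B * q ^ n * (1 - q ^ k) / (1 - q)).
  { induction k as [|k IH].
    - rewrite Nat.add_0_r. replace (_ - _)%C with (RtoC 0) by ring. rewrite Cmod_0.
      simpl. right. field. lra.
    - rewrite Nat.add_succ_r, psum_S.
      replace (psum a z (n + k) + z ^ S (n + k) * a (S (n + k)) - psum a z n)%C
        with ((psum a z (n + k) - psum a z n) + z ^ S (n + k) * a (S (n + k)))%C by ring.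
      eapply Rle_trans; [apply Cmod_triangle|].
      specialize (T (S (n + k))).
      assert (T' : Cmod (z ^ S (n + k) * a (S (n + k)))%C <= B * q ^ n * q ^ k).
      { eapply Rle_trans; [exact T|]. rewrite Rmult_assoc, <- pow_add.
        apply Rmult_le_compat_l; auto. simpl.
        assert (0 <= q ^ (n + k)) by (apply pow_le; lra). nra. }
      eapply Rle_trans; [apply Rplus_le_compat; [exact IH|exact T']|]. right. simpl. field. lra. }
  assert (L : Cmod (f z - psum a z n)%C <= B / (1 - q) * q ^ n).
  { apply clim_le with (u := fun k => (psum a z k - psum a z n)%C) (N0 := n).
    - intros k Hk. replace k with (n + (k - n))%nat by lia. eapply Rle_trans; [apply D|].
      assert (0 <= q ^ (k - n)) by (apply pow_le; lra). assert (0 <= q ^ n) by (apply pow_le; lra).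
      assert (0 < / (1 - q)) by (apply Rinv_0_lt_compat; lra). unfold Rdiv.
      replace (B * / (1 - q) * q ^ n) with (B * q ^ n * 1 * / (1 - q)) by ring.
      apply Rmult_le_compat_r; [lra|]. apply Rmult_le_compat_l; [|lra]. now apply Rmult_le_pos.
    - apply clim_minus_const. apply expansion_clim. lra. }
  rewrite Cmod_minus_sym. eapply Rle_trans; [exact L|]. left. now apply HN.
Qed.
End Coefficients.

Lemma psum_shift a z n : psum a z (S n) = (a O + z * psum (fun k => a (S k)) z n)%C.
Proof.
  induction n as [|n IH].
  - rewrite psum_S, !psum_O. simpl. ring.
  - rewrite psum_S, IH, psum_S, (Cpow_S z (S n)). ring.
Qed.

Lemma Cmod2_plus u v : Cmod (u + v)%C ^ 2 = Cmod u ^ 2 + Cmod v ^ 2 + 2 * Re (Cconj u * v)%C.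
Proof. rewrite !Cmod2_alt. destruct u, v. simpl. ring. Qed.

(** Parseval's identity for a polynomial on the circle of radius [r]: peeling
    off the constant term leaves a cross term of mean zero. *)
Lemma parseval_psum r a n : 0 < r ->
  is_RInt (fun t => Cmod (psum a (circ r t) n) ^ 2) 0 (2 * PI)
    (2 * PI * sum_f_R0 (fun k => Cmod (a k) ^ 2 * (r ^ k) ^ 2) n).
Proof.
  intros Hr. revert a. induction n as [|n IH]; intros a.
  - eapply is_RInt_ext with (f := fun _ => Cmod (a O) ^ 2).
    { intros t _. now rewrite psum_O. }
    replace (2 * PI * sum_f_R0 _ 0) with (scal (2 * PI - 0) (Cmod (a O) ^ 2)).
    apply (@is_RInt_const R_NormedModule). unfold scal; simpl; unfold mult; simpl. ring.
  - apply is_RInt_ext with (f := fun t => Cmod (a O) ^ 2 + r ^ 2 * Cmod (psum (fun k => a (S k)) (circ r t) n) ^ 2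
        + 2 * Re (Cconj (a O) * (circ r t * psum (fun k => a (S k)) (circ r t) n))%C).
    { intros t _. now rewrite psum_shift, Cmod2_plus, Cmod_mult, Cmod_circ, Rpow_mult_distr by lra. }
    assert (X : is_CInt (fun t => Cconj (a O) * (circ r t * psum (fun k => a (S k)) (circ r t) n))%C 0 (2 * PI) (RtoC 0)).
    { replace (RtoC 0) with (Cconj (a O) * csum (fun k => a (S k) * RtoC 0) n)%C.
      2:{ rewrite <- (csum_ext (fun k => RtoC 0 * a (S k))%C) by (intros; ring).
          rewrite <- csum_scal. ring. }
      apply is_CInt_scal.
      apply is_CInt_ext with (fun t => csum (fun k => a (S k) * circ r t ^ S k)%C n).
      { intros t _. unfold psum. rewrite csum_scal. apply csum_ext. intros k _. rewrite Cpow_S. ring. }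
      apply is_CInt_csum. intros k. apply is_CInt_scal. apply is_CInt_circ_pow. lia. }
    assert (Y := is_RInt_plus _ _ _ _ _ _
      (is_RInt_plus _ _ _ _ _ _ (is_RInt_const (V := R_NormedModule) 0 (2 * PI) (Cmod (a O) ^ 2))
        (is_RInt_scal (V := R_NormedModule) _ _ _ (r ^ 2) _ (IH (fun k => a (S k)))))
      (is_RInt_scal (V := R_NormedModule) _ _ _ 2 _ (proj1 X))).
    match type of Y with is_RInt _ _ _ ?l => replace (2 * PI * _) with l end. exact Y.
    rewrite (decomp_sum _ (S n)) by lia. simpl Nat.pred.
    replace (sum_f_R0 (fun k => Cmod (a (S k)) ^ 2 * (r ^ S k) ^ 2) n)
      with (r ^ 2 * sum_f_R0 (fun k => Cmod (a (S k)) ^ 2 * (r ^ k) ^ 2) n).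
    2:{ rewrite scal_sum. apply sum_eq. intros k _. simpl. ring. }
    unfold scal, plus; simpl; unfold mult; simpl. ring.
Qed.

Lemma bernoulli_below x n : 0 <= x <= 1 -> 1 - INR n * x <= (1 - x) ^ n.
Proof.
  intros Hx. induction n as [|n IH].
  - simpl. lra.
  - rewrite S_INR. simpl.
    assert (0 <= INR n * (x * x)).
    { apply Rmult_le_pos; [apply pos_INR|]. apply Rmult_le_pos; lra. }
    assert ((1 - x) * (1 - INR n * x) <= (1 - x) * (1 - x) ^ n) by (apply Rmult_le_compat_l; lra).
    nra.
Qed.

Lemma sum_f_R0_mono (u : nat -> R) n m :
  (forall k, 0 <= u k) -> (n <= m)%nat -> sum_f_R0 u n <= sum_f_R0 u m.
Proof.
  intros Hu H. induction H as [|m H IH]; [lra|]. simpl. specialize (Hu (S m)). lra.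
Qed.

Section SquareSummable.
Variables (a : nat -> C) (f : C -> C) (M : R).
Hypothesis Hexp : expansion a f.
Hypothesis HM : forall z, Cmod z < 1 -> Cmod (f z) <= M.

(** Parseval bounds [sum |a_k|^2 r^(2k)] by the square of the maximum of a
    partial sum, which is at most [M + 1] when the partial sum is long. For a
    radius close to [1], depending on [N], the factors [r^(2k)] with [k <= N]
    are at least [1/2]. *)
Lemma coeff_square_summable N : sum_f_R0 (fun k => Cmod (a k) ^ 2) N <= 2 * (M + 1) ^ 2.
Proof.
  assert (HP := PI_RGT_0).
  assert (HM0 : 0 <= M).
  { eapply Rle_trans; [|apply (HM (RtoC 0)); rewrite Cmod_0; lra]. apply Cmod_ge_0. }
  set (x := / (4 * (INR N + 1))).
  assert (HN := pos_INR N).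
  assert (Hx : 0 < x) by (apply Rinv_0_lt_compat; lra).
  assert (Ex : x * (4 * (INR N + 1)) = 1) by (unfold x; field; lra).
  set (r := 1 - x). assert (Hr : 0 < r < 1) by (unfold r; nra).
  assert (Pr : forall k, 0 <= r ^ k) by (intros; apply pow_le; lra).
  destruct (psum_uniform a f Hexp r 1 ltac:(lra) ltac:(lra)) as [N0 HN0].
  set (n := Nat.max N N0).
  assert (B : 2 * PI * sum_f_R0 (fun k => Cmod (a k) ^ 2 * (r ^ k) ^ 2) n <= 2 * PI * (M + 1) ^ 2).
  { apply (is_RInt_le (fun t => Cmod (psum a (circ r t) n) ^ 2) (fun _ => (M + 1) ^ 2) 0 (2 * PI)).
    - lra.
    - apply parseval_psum. lra.
    - replace (2 * PI * (M + 1) ^ 2) with (scal (2 * PI - 0) ((M + 1) ^ 2)).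
      apply (@is_RInt_const R_NormedModule). unfold scal; simpl; unfold mult; simpl. ring.
    - intros t _. apply pow_incr. split; [apply Cmod_ge_0|].
      assert (Hz : Cmod (circ r t) = r) by (apply Cmod_circ; lra).
      assert (h := HN0 n (circ r t) ltac:(unfold n; lia) ltac:(lra)).
      assert (h' := Cmod_triangle_rev (psum a (circ r t) n) (f (circ r t))).
      assert (h'' := HM (circ r t) ltac:(lra)). lra. }
  apply Rmult_le_reg_l in B; [|lra].
  assert (B' : sum_f_R0 (fun k => Cmod (a k) ^ 2 * (r ^ k) ^ 2) N <= (M + 1) ^ 2).
  { eapply Rle_trans; [|exact B]. apply sum_f_R0_mono; [|unfold n; lia].
    intros k. apply Rmult_le_pos; apply pow2_ge_0. }
  assert (Q : / 2 <= (r ^ N) ^ 2).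
  { assert (h := bernoulli_below x N ltac:(nra)). fold r in h.
    assert (INR N * x <= 1 / 4) by nra. simpl. specialize (Pr N). nra. }
  assert (L : sum_f_R0 (fun k => Cmod (a k) ^ 2) N * / 2
     <= sum_f_R0 (fun k => Cmod (a k) ^ 2 * (r ^ k) ^ 2) N).
  { rewrite Rmult_comm, scal_sum. apply sum_Rle. intros k Hk.
    apply Rmult_le_compat_l; [apply pow2_ge_0|]. eapply Rle_trans; [exact Q|].
    apply pow_incr. split; auto.
    replace N with (k + (N - k))%nat by lia. rewrite pow_add.
    rewrite <- (Rmult_1_r (r ^ k)) at 2. apply Rmult_le_compat_l; auto.
    rewrite <- (pow1 (N - k)). apply pow_incr. lra. }
  lra.
Qed.

Lemma sum_inv_square_le N : sum_f_R0 (fun k => / (INR k + 1) ^ 2) N <= 2 - / (INR N + 1).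
Proof.
  induction N as [|N IH].
  - simpl. lra.
  - rewrite tech5, S_INR. assert (h := pos_INR N).
    assert (/ (INR N + 1 + 1) ^ 2 <= / (INR N + 1) - / (INR N + 1 + 1)); [|lra].
    replace (/ (INR N + 1) - / (INR N + 1 + 1)) with (/ ((INR N + 1) * (INR N + 1 + 1))) by (field; lra).
    apply Rinv_le_contravar; nra.
Qed.

(** From [2 x y <= x^2 + y^2] with [x = |a_k|] and [y = 1 / (k + 1)]. *)
Lemma coeff_hardy_bound N : sum_f_R0 (fun k => Cmod (a k) / (INR k + 1)) N <= (M + 1) ^ 2 + 1.
Proof.
  apply Rle_trans with (sum_f_R0 (fun k => Cmod (a k) ^ 2 * / 2 + / (INR k + 1) ^ 2 * / 2) N).
  - apply sum_Rle. intros k _. assert (h := pos_INR k).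
    rewrite <- pow_inv by lra. unfold Rdiv.
    assert (h' := pow2_ge_0 (Cmod (a k) - / (INR k + 1))). nra.
  - rewrite sum_plus, <- !scal_sum.
    assert (h1 := coeff_square_summable N). assert (h2 := sum_inv_square_le N).
    assert (0 < / (INR N + 1)). { apply Rinv_0_lt_compat. assert (h := pos_INR N). lra. }
    lra.
Qed.
End SquareSummable.

(** * The Hilbert matrix on bounded functions *)

Lemma is_CInt_monomial c m : is_CInt (fun t => RtoC (t ^ m) * c)%C 0 1 (c / RtoC (INR (m + 1)))%C.
Proof.
  assert (Hm : INR (m + 1) <> 0) by (apply not_0_INR; lia).
  assert (I : is_RInt (fun t => t ^ m) 0 1 (/ INR (m + 1))).
  { assert (D : is_RInt (fun t => t ^ m) 0 1 (minus (1 ^ (m + 1) / INR (m + 1)) (0 ^ (m + 1) / INR (m + 1)))).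
    { apply (is_RInt_derive (V := R_CompleteNormedModule) (fun t => t ^ (m + 1) / INR (m + 1))).
      - intros x _. auto_derive; auto. replace (pred (m + 1)) with m by lia. field; auto.
      - intros x _. apply (ex_derive_continuous (V := R_NormedModule)). auto_derive; auto. }
    replace (minus _ _) with (/ INR (m + 1)) in D; [exact D|].
    rewrite pow1, pow_i by lia. unfold minus, plus, opp; simpl. field; auto. }
  replace (c / RtoC (INR (m + 1)))%C with (c * RtoC (/ INR (m + 1)))%C.
  2:{ rewrite RtoC_inv by auto. reflexivity. }
  apply is_CInt_ext with (fun t => c * RtoC (t ^ m))%C. { intros t _. ring. }
  apply is_CInt_scal. split; simpl; [exact I|].
  assert (Z := is_RInt_const (V := R_NormedModule) 0 1 0).
  replace (scal _ _) with 0 in Z; [exact Z|]. unfold scal; simpl; unfold mult; simpl. ring.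
Qed.

Lemma is_RInt_monomial_sum (u : nat -> R) N :
  is_RInt (fun t => sum_f_R0 (fun n => t ^ n * u n) N) 0 1 (sum_f_R0 (fun n => u n / INR (n + 1)) N).
Proof.
  assert (I : forall n, is_RInt (fun t => t ^ n * u n) 0 1 (u n / INR (n + 1))).
  { intros n. destruct (is_CInt_monomial (RtoC (u n)) n) as [I _].
    rewrite <- RtoC_div in I by (apply not_0_INR; lia).
    eapply is_RInt_ext; [|exact I]. intros t _. simpl. ring. }
  induction N as [|N IH]; [apply I|].
  apply (@is_RInt_plus R_NormedModule); [exact IH|apply I].
Qed.

(** The double sum is the integral over [0,1] of the polynomial [psum a (c * t) K]
    times [sum_n z^n t^n], because [1 / (n + k + 1)] is the integral of
    [t^(n + k)]. *)
Lemma hilbert_finite_sum_le (a : nat -> C) z c N K B :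
  (forall t, 0 <= t <= 1 -> Cmod (psum a (RtoC (c * t)) K) <= B) ->
  Cmod (csum (fun n => z ^ n * csum (fun k => RtoC (c ^ k) * a k / RtoC (INR (n + k + 1))) K)%C N)
    <= B * sum_f_R0 (fun n => Cmod z ^ n / INR (n + 1)) N.
Proof.
  intros HB.
  assert (I : is_CInt (fun t => csum (fun n => z ^ n * csum (fun k => RtoC (t ^ (n + k)) * (RtoC (c ^ k) * a k)) K)%C N) 0 1
     (csum (fun n => z ^ n * csum (fun k => RtoC (c ^ k) * a k / RtoC (INR (n + k + 1))) K)%C N)).
  { apply (is_CInt_csum (fun n t => z ^ n * csum (fun k => RtoC (t ^ (n + k)) * (RtoC (c ^ k) * a k)) K)%C).
    intros n. apply is_CInt_scal.
    apply (is_CInt_csum (fun k t => RtoC (t ^ (n + k)) * (RtoC (c ^ k) * a k))%C).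
    intros k. apply is_CInt_monomial. }
  rewrite scal_sum.
  rewrite (sum_eq _ (fun n => Cmod z ^ n * B / INR (n + 1))).
  2:{ intros n _. field. apply not_0_INR; lia. }
  refine (is_CInt_le _ (fun t => sum_f_R0 (fun n => t ^ n * (Cmod z ^ n * B)) N) 0 1 _ _ Rle_0_1 _ I _).
  2:{ apply (is_RInt_monomial_sum (fun n => Cmod z ^ n * B)). }
  intros t Ht. eapply Rle_trans; [apply Cmod_csum_le|]. apply sum_Rle. intros n _.
  replace (csum (fun k => RtoC (t ^ (n + k)) * (RtoC (c ^ k) * a k))%C K)
    with (RtoC (t ^ n) * psum a (RtoC (c * t)) K)%C.
  2:{ unfold psum. rewrite csum_scal. apply csum_ext. intros k _.
      rewrite <- RtoC_pow, Rpow_mult_distr, pow_add, !RtoC_mult. ring. }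
  assert (Pt : 0 <= t ^ n) by (apply pow_le; lra).
  rewrite !Cmod_mult, Cmod_pow, Cmod_R, Rabs_right by lra.
  replace (t ^ n * (Cmod z ^ n * B)) with (Cmod z ^ n * (t ^ n * B)) by ring.
  apply Rmult_le_compat_l; [apply pow_le, Cmod_ge_0|]. apply Rmult_le_compat_l; auto.
Qed.

Lemma csum_plus (u v : nat -> C) n : (csum u n + csum v n)%C = csum (fun k => u k + v k)%C n.
Proof.
  induction n as [|n IH]; [now rewrite !csum_O|]. rewrite !csum_S, <- IH. ring.
Qed.

Lemma csum_minus (u v : nat -> C) n : (csum u n - csum v n)%C = csum (fun k => u k - v k)%C n.
Proof.
  induction n as [|n IH]; [now rewrite !csum_O|]. rewrite !csum_S, <- IH. ring.
Qed.

Lemma sum_const x n : sum_f_R0 (fun _ => x) n = (INR n + 1) * x.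
Proof. rewrite sum_cte, S_INR. ring. Qed.

Lemma Rle_of_eps x y c : 0 <= c -> (forall eps, 0 < eps -> x <= y + eps * c) -> x <= y.
Proof.
  intros Hc H. apply Rnot_lt_le. intros h.
  specialize (H ((x - y) / (2 * (c + 1)))).
  assert (0 < (x - y) / (2 * (c + 1))) by (apply Rdiv_lt_0_compat; lra).
  specialize (H H0).
  assert ((x - y) / (2 * (c + 1)) * (2 * (c + 1)) = x - y) by (field; lra). nra.
Qed.

Section Hilbert.
Variables (a : nat -> C) (f : C -> C) (M : R).
Hypothesis Hexp : expansion a f.
Hypothesis HM : forall z, Cmod z < 1 -> Cmod (f z) <= M.

Let A (k : nat) : R := Cmod (a k) / (INR k + 1).

Lemma hardy_term_nonneg k : 0 <= A k.
Proof.
  unfold A. apply Rmult_le_pos; [apply Cmod_ge_0|]. left. apply Rinv_0_lt_compat.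
  assert (h := pos_INR k). lra.
Qed.

Lemma hilbert_term_le n k : Cmod (a k / RtoC (INR (n + k + 1)))%C <= A k.
Proof.
  unfold A. assert (h := pos_INR k). assert (h' := pos_INR n).
  rewrite Cmod_div, Cmod_R, Rabs_right, !plus_INR.
  - simpl INR. apply Rmult_le_compat_l; [apply Cmod_ge_0|]. apply Rinv_le_contravar; lra.
  - apply Rle_ge, pos_INR.
  - intros E. apply RtoC_inj in E. revert E. apply not_0_INR. lia.
Qed.

Lemma hilbert_coeff_exists n : exists b,
  @is_series C_AbsRing C_NormedModule (fun k => Cdiv (a k) (RtoC (INR (n + k + 1)))) b.
Proof.
  destruct (dominated_clim (fun k => a k / RtoC (INR (n + k + 1)))%C A ((M + 1) ^ 2 + 1)) as [b Hb].
  - apply hilbert_term_le.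
  - apply (coeff_hardy_bound a f M Hexp HM).
  - exists b. now apply is_series_C.
Qed.

Variable b : nat -> C.
Hypothesis Hb : forall n,
  @is_series C_AbsRing C_NormedModule (fun k => Cdiv (a k) (RtoC (INR (n + k + 1)))) (b n).

Lemma hilbert_coeff_clim n : clim (csum (fun k => a k / RtoC (INR (n + k + 1)))%C) (b n).
Proof. apply is_series_C, Hb. Qed.

Lemma hilbert_coeff_bounded n : Cmod (b n) <= (M + 1) ^ 2 + 1.
Proof.
  eapply clim_le with (N0 := O); [|apply hilbert_coeff_clim].
  intros k _. eapply Rle_trans; [apply Cmod_csum_le|].
  eapply Rle_trans; [|apply (coeff_hardy_bound a f M Hexp HM k)].
  apply sum_Rle. intros j _. apply hilbert_term_le.
Qed.

Lemma hardy_tail eps : 0 < eps -> exists K0, forall K, (K0 <= K)%nat ->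
  sum_f_R0 A K - sum_f_R0 A K0 <= eps.
Proof.
  intros He.
  destruct (ex_series_bounded A ((M + 1) ^ 2 + 1) hardy_term_nonneg (coeff_hardy_bound a f M Hexp HM)) as [l Hl].
  assert (L : is_lim_seq (sum_n A) l) by exact Hl.
  assert (I : forall n, sum_n A n <= l).
  { apply is_lim_seq_incr_compare; auto. intros n. rewrite sum_Sn.
    change (plus (sum_n A n) (A (S n))) with (sum_n A n + A (S n)).
    assert (h := hardy_term_nonneg (S n)). lra. }
  apply is_lim_seq_spec in L. destruct (L (mkposreal eps He)) as [K0 HK].
  exists K0. intros K HK'. specialize (HK K0 (le_n _)). specialize (I K). simpl in HK.
  rewrite !sum_n_Reals in *. apply Rabs_def2 in HK. lra.
Qed.

(** [f (c * t)] with [c < 1] is a uniform limit of polynomials on [0,1], so the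
    integral estimate applies to it; the factor [c ^ k] is then removed at a
    cost controlled by the tail of the absolutely convergent series. *)
Lemma hilbert_psum_le z N : Cmod z <= 1 ->
  Cmod (psum b z N) <= M * sum_f_R0 (fun n => Cmod z ^ n / INR (n + 1)) N.
Proof.
  intros Hz. set (Q := sum_f_R0 (fun n => Cmod z ^ n / INR (n + 1)) N).
  assert (HQ : 0 <= Q).
  { apply sum_nonneg. intros n. apply Rmult_le_pos; [apply pow_le, Cmod_ge_0|].
    left. apply Rinv_0_lt_compat, lt_0_INR. lia. }
  assert (HN := pos_INR N).
  set (D := (M + 1) ^ 2 + 1). assert (HD : 0 < D) by (unfold D; assert (h := pow2_ge_0 (M + 1)); lra).
  apply Rle_of_eps with (c := 2 * (INR N + 1) + Q); [lra|]. intros eps He.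
  destruct (hardy_tail eps He) as [K0 HK0].
  assert (HK := pos_INR K0).
  (* With [c = 1 - x] one has [1 - c ^ k <= K0 * x] for [k <= K0], and [D] bounds
     the sum of the [A k]. *)
  set (x := Rmin 1 (eps / (D * (INR K0 + 1))) / 2).
  assert (Hx : 0 < Rmin 1 (eps / (D * (INR K0 + 1)))).
  { apply Rmin_pos; [lra|]. apply Rdiv_lt_0_compat; auto. apply Rmult_lt_0_compat; lra. }
  assert (x1 : x <= 1 / 2) by (unfold x; assert (h := Rmin_l 1 (eps / (D * (INR K0 + 1)))); lra).
  assert (x2 : x * (D * (INR K0 + 1)) <= eps).
  { assert (h := Rmin_r 1 (eps / (D * (INR K0 + 1)))).
    apply Rle_trans with (eps / (D * (INR K0 + 1)) * (D * (INR K0 + 1))).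
    - apply Rmult_le_compat_r; [|unfold x; lra]. apply Rmult_le_pos; lra.
    - right. field. lra. }
  assert (x0 : 0 < x) by (unfold x; lra).
  set (c := 1 - x). assert (Hc : 0 <= c < 1) by (unfold c; lra).
  destruct (psum_uniform a f Hexp c eps Hc He) as [K1 HK1].
  apply clim_le with (N0 := Nat.max K0 K1)
    (u := fun K => csum (fun n => z ^ n * csum (fun k => a k / RtoC (INR (n + k + 1))) K)%C N).
  2:{ unfold psum. apply (clim_csum (fun n K => z ^ n * csum (fun k => a k / RtoC (INR (n + k + 1))) K)%C).
      intros n. apply clim_scal. apply hilbert_coeff_clim. }
  intros K HK'.
  set (S1 := csum (fun n => z ^ n * csum (fun k => a k / RtoC (INR (n + k + 1))) K)%C N).
  set (S2 := csum (fun n => z ^ n * csum (fun k => RtoC (c ^ k) * a k / RtoC (INR (n + k + 1))) K)%C N).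
  assert (B2 : Cmod S2 <= (M + eps) * Q).
  { apply hilbert_finite_sum_le. intros t Ht.
    assert (Hw : Cmod (RtoC (c * t)) <= c) by (rewrite Cmod_R, Rabs_right; nra).
    assert (h := HK1 K (RtoC (c * t)) ltac:(lia) Hw).
    assert (h' := Cmod_triangle_rev (psum a (RtoC (c * t)) K) (f (RtoC (c * t)))).
    assert (h'' := HM (RtoC (c * t)) ltac:(lra)). lra. }
  assert (W : sum_f_R0 (fun k => A k * (1 - c ^ k)) K <= 2 * eps).
  { assert (Pc : forall k, 0 <= c ^ k <= 1).
    { intros k. split; [apply pow_le; lra|]. rewrite <- (pow1 k). apply pow_incr. lra. }
    assert (G : forall K, (K0 <= K)%nat -> sum_f_R0 (fun k => A k * (1 - c ^ k)) K <=
        D * (INR K0 * x) + (sum_f_R0 A K - sum_f_R0 A K0)).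
    { intros K' H. induction H as [|K' H IH].
      - replace (_ - _) with 0 by ring. rewrite Rplus_0_r.
        apply Rle_trans with (sum_f_R0 A K0 * (INR K0 * x)).
        + rewrite Rmult_comm, scal_sum. apply sum_Rle. intros k Hk.
          apply Rmult_le_compat_l; [apply hardy_term_nonneg|].
          assert (h := bernoulli_below x k ltac:(lra)). fold c in h.
          apply le_INR in Hk. nra.
        + apply Rmult_le_compat_r; [apply Rmult_le_pos; lra|]. apply (coeff_hardy_bound a f M Hexp HM).
      - rewrite !tech5. assert (h := hardy_term_nonneg (S K')). specialize (Pc (S K')).
        assert (A (S K') * (1 - c ^ S K') <= A (S K') * 1) by (apply Rmult_le_compat_l; lra). lra. }
    specialize (G K ltac:(lia)). specialize (HK0 K ltac:(lia)). nra. }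
  assert (B1 : Cmod (S1 - S2)%C <= (INR N + 1) * (2 * eps)).
  { unfold S1, S2. rewrite csum_minus. eapply Rle_trans; [apply Cmod_csum_le|].
    rewrite <- sum_const. apply sum_Rle. intros n _.
    rewrite <- (Rmult_1_l (2 * eps)).
    replace (z ^ n * csum (fun k => a k / RtoC (INR (n + k + 1))) K -
      z ^ n * csum (fun k => RtoC (c ^ k) * a k / RtoC (INR (n + k + 1))) K)%C
      with (z ^ n * csum (fun k => RtoC (1 - c ^ k) * (a k / RtoC (INR (n + k + 1)))) K)%C.
    2:{ replace (csum (fun k => RtoC (1 - c ^ k) * (a k / RtoC (INR (n + k + 1)))) K)%C
          with (csum (fun k => a k / RtoC (INR (n + k + 1))) K -
            csum (fun k => RtoC (c ^ k) * a k / RtoC (INR (n + k + 1))) K)%C. ring.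
        rewrite csum_minus. apply csum_ext. intros k _. rewrite RtoC_minus. unfold Cdiv. ring. }
    rewrite Cmod_mult, Cmod_pow. apply Rmult_le_compat; try apply Cmod_ge_0.
    - apply pow_le, Cmod_ge_0.
    - rewrite <- (pow1 n). apply pow_incr. split; [apply Cmod_ge_0|auto].
    - eapply Rle_trans; [apply Cmod_csum_le|]. eapply Rle_trans; [|exact W].
      apply sum_Rle. intros k _.
      assert (c ^ k <= 1) by (rewrite <- (pow1 k); apply pow_incr; lra).
      rewrite Cmod_mult, Cmod_R, Rabs_right, Rmult_comm by lra.
      apply Rmult_le_compat_r; [lra|apply hilbert_term_le]. }
  assert (T := Cmod_triangle_rev S1 S2). lra.
Qed.
End Hilbert.

(** * Power series with bounded coefficients *)

Lemma geom_sum_le s N : 0 <= s < 1 -> (1 - s) * sum_f_R0 (fun n => s ^ n) N = 1 - s ^ S N.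
Proof.
  intros Hs. induction N as [|N IH]; [simpl; ring|].
  rewrite tech5, Rmult_plus_distr_l, IH. simpl. ring.
Qed.

(** The difference vanishes at [0] and its derivative is the remainder of the
    geometric series. *)
Lemma log_partial_sum_le x N : 0 <= x < 1 ->
  sum_f_R0 (fun n => x ^ (n + 1) / INR (n + 1)) N <= - ln (1 - x).
Proof.
  intros Hx.
  assert (I : forall y, is_derive (fun x => sum_f_R0 (fun n => x ^ (n + 1) / INR (n + 1)) N) y (sum_f_R0 (fun n => y ^ n) N)).
  { intros y. assert (D : forall n, is_derive (fun x => x ^ (n + 1) / INR (n + 1)) y (y ^ n)).
    { intros n. assert (INR (n + 1) <> 0) by (apply not_0_INR; lia).
      auto_derive; auto. replace (pred (n + 1)) with n by lia. field; auto. }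
    induction N as [|N IH]; [apply D|]. apply (@is_derive_plus R_AbsRing R_NormedModule); auto. }
  assert (J : forall y, y < 1 -> is_derive (fun x => - ln (1 - x) - sum_f_R0 (fun n => x ^ (n + 1) / INR (n + 1)) N) y
    (/ (1 - y) - sum_f_R0 (fun n => y ^ n) N)).
  { intros y Hy. apply (@is_derive_minus R_AbsRing R_NormedModule); auto. auto_derive; [lra|]. field. lra. }
  destruct (MVT_gen (fun x => - ln (1 - x) - sum_f_R0 (fun n => x ^ (n + 1) / INR (n + 1)) N) 0 x
    (fun y => / (1 - y) - sum_f_R0 (fun n => y ^ n) N)) as [y [Hy E]].
  - intros y. rewrite Rmin_left, Rmax_right by lra. intros Hy.
    apply J. lra.
  - intros y. rewrite Rmin_left, Rmax_right by lra. intros Hy.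
    apply continuity_pt_filterlim.
    apply (ex_derive_continuous (V := R_NormedModule) (fun x => - ln (1 - x) - sum_f_R0 (fun n => x ^ (n + 1) / INR (n + 1)) N) y).
    eexists. apply J. lra.
  - rewrite Rmin_left, Rmax_right in Hy by lra.
    assert (Z : sum_f_R0 (fun n => 0 ^ (n + 1) / INR (n + 1)) N = 0).
    { rewrite (sum_eq _ (fun _ => 0)). rewrite sum_const; ring.
      intros n _. rewrite pow_i by lia. unfold Rdiv. ring. }
    cbv beta in E. replace (1 - 0) with 1 in E by ring. rewrite Z, ln_1 in E.
    assert (G := geom_sum_le y N ltac:(lra)).
    assert (P : 0 <= y ^ S N) by (apply pow_le; lra).
    assert (0 <= / (1 - y) - sum_f_R0 (fun n => y ^ n) N); [|nra].
    assert (sum_f_R0 (fun n => y ^ n) N <= / (1 - y)); [|lra].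
    apply Rmult_le_reg_l with (1 - y); [lra|]. rewrite Rinv_r; lra.
Qed.

(** The term [n = 0] is [1], and for [n >= 1] the denominator [n + 1] is larger
    than in the series of the logarithm. *)
Lemma hilbert_weight_le r N : 0 <= r < 1 ->
  sum_f_R0 (fun n => r ^ n / INR (n + 1)) N <= 1 - ln (1 - r).
Proof.
  intros Hr.
  assert (L0 := log_partial_sum_le r 0 Hr). simpl in L0.
  destruct N as [|N].
  - simpl. lra.
  - rewrite decomp_sum by lia. simpl Nat.pred.
    assert (sum_f_R0 (fun n => r ^ S n / INR (S n + 1)) N <= sum_f_R0 (fun n => r ^ (n + 1) / INR (n + 1)) N).
    { apply sum_Rle. intros n _. replace (n + 1)%nat with (S n) by lia.
      apply Rmult_le_compat_l; [apply pow_le; lra|]. apply Rinv_le_contravar.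
      - apply lt_0_INR; lia.
      - apply le_INR; lia. }
    assert (L := log_partial_sum_le r N Hr). simpl pow at 1. simpl INR at 1. lra.
Qed.

Lemma quadratic_weight_sum s N : 0 <= s < 1 ->
  sum_f_R0 (fun k => (INR k + 1) * (INR k + 2) * s ^ k) N <= 2 / (1 - s) ^ 3.
Proof.
  intros Hs.
  (* [T n] is the tail of the series from the index [n] on, in closed form. *)
  set (T := fun n => s ^ n * ((INR n + 1) * (INR n + 2) / (1 - s) + 2 * (INR n + 2) * s / (1 - s) ^ 2
     + 2 * s ^ 2 / (1 - s) ^ 3)).
  assert (E : forall n, sum_f_R0 (fun k => (INR k + 1) * (INR k + 2) * s ^ k) n = T O - T (S n)).
  { induction n as [|n IH].
    - unfold T. simpl. field. lra.
    - rewrite tech5, IH. unfold T. rewrite !S_INR. simpl pow. field. lra. }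
  rewrite E. assert (P : 0 <= T (S N)).
  { unfold T. assert (h := pos_INR (S N)). assert (h' : 0 < 1 - s) by lra.
    apply Rmult_le_pos; [apply pow_le; lra|].
    repeat apply Rplus_le_le_0_compat; unfold Rdiv; apply Rmult_le_pos;
      try (left; apply Rinv_0_lt_compat; try apply pow_lt; lra); nra. }
  assert (T O = 2 / (1 - s) ^ 3); [|lra]. unfold T. simpl. field. lra.
Qed.

(** The remainders [E_n] satisfy [E_(n+1) = w E_n + n z^(n-1) (w - z)^2]; the
    factor [s ^ 2] avoids negative exponents for [n < 2]. *)
Lemma power_remainder (z w : C) s n :
  Cmod z <= s -> Cmod w <= s ->
  s ^ 2 * Cmod (w ^ n - z ^ n - RtoC (INR n) * z ^ (pred n) * (w - z))%C
    <= INR n ^ 2 * s ^ n * Cmod (w - z)%C ^ 2.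
Proof.
  intros Hz Hw. assert (P := Cmod_ge_0 z). assert (Q := Cmod_ge_0 w).
  set (d := Cmod (w - z)%C). assert (Pd : 0 <= d) by apply Cmod_ge_0.
  induction n as [|n IH].
  - simpl. replace (_ - _ - _)%C with (RtoC 0) by ring. rewrite Cmod_0. lra.
  - set (E := Cmod (w ^ n - z ^ n - RtoC (INR n) * z ^ pred n * (w - z))%C) in *.
    assert (X : Cmod (w ^ S n - z ^ S n - RtoC (INR (S n)) * z ^ pred (S n) * (w - z))%C
      <= s * E + INR n * Cmod z ^ pred n * d ^ 2).
    { replace (w ^ S n - z ^ S n - RtoC (INR (S n)) * z ^ pred (S n) * (w - z))%C
        with (w * (w ^ n - z ^ n - RtoC (INR n) * z ^ pred n * (w - z))
          + RtoC (INR n) * z ^ pred n * ((w - z) * (w - z)))%C.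
      - eapply Rle_trans; [apply Cmod_triangle|]. rewrite !Cmod_mult, Cmod_pow, Cmod_R, Rabs_right.
        2:{ apply Rle_ge, pos_INR. }
        fold E d. assert (0 <= E) by apply Cmod_ge_0. simpl (d ^ 2). rewrite Rmult_1_r. nra.
      - rewrite S_INR, RtoC_plus. destruct n as [|n]; simpl pred.
        + simpl. ring.
        + rewrite !Cpow_S. ring. }
    assert (Y : s ^ 2 * (INR n * Cmod z ^ pred n) <= INR n * s ^ S n).
    { destruct n as [|n]. { simpl. lra. }
      simpl pred. replace (s ^ 2 * (INR (S n) * Cmod z ^ n)) with (INR (S n) * s ^ 2 * Cmod z ^ n) by ring.
      replace (INR (S n) * s ^ S (S n)) with (INR (S n) * s ^ 2 * s ^ n) by (simpl; ring).
      apply Rmult_le_compat_l. { apply Rmult_le_pos; [apply pos_INR|apply pow2_ge_0]. }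
      apply pow_incr; lra. }
    assert (Ps : 0 <= s ^ n) by (apply pow_le; lra).
    apply Rle_trans with (s ^ 2 * (s * E + INR n * Cmod z ^ pred n * d ^ 2)).
    { apply Rmult_le_compat_l; [apply pow2_ge_0|exact X]. }
    apply Rle_trans with (s * (INR n ^ 2 * s ^ n * d ^ 2) + INR n * s ^ S n * d ^ 2).
    { assert (s * (s ^ 2 * E) <= s * (INR n ^ 2 * s ^ n * d ^ 2)) by (apply Rmult_le_compat_l; lra).
      assert (s ^ 2 * (INR n * Cmod z ^ pred n) * d ^ 2 <= INR n * s ^ S n * d ^ 2).
      { apply Rmult_le_compat_r; [apply pow2_ge_0|exact Y]. }
      lra. }
    rewrite S_INR. assert (h := pos_INR n).
    replace ((INR n + 1) ^ 2 * s ^ S n * d ^ 2) with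
      (s * (INR n ^ 2 * s ^ n * d ^ 2) + INR n * s ^ S n * d ^ 2 + (INR n + 1) * s ^ S n * d ^ 2)
      by (simpl; ring).
    assert (0 <= (INR n + 1) * s ^ S n * d ^ 2); [|lra].
    apply Rmult_le_pos; [|apply pow2_ge_0]. apply Rmult_le_pos; [lra|]. apply pow_le; lra.
Qed.

Section BoundedCoefficients.
Variables (b : nat -> C) (D : R).
Hypothesis HD : forall n, Cmod (b n) <= D.

Lemma psum_converges z : Cmod z < 1 -> exists l, clim (psum b z) l.
Proof.
  intros Hz. assert (P := Cmod_ge_0 z).
  assert (D0 : 0 <= D) by (eapply Rle_trans; [apply Cmod_ge_0|apply (HD O)]).
  apply (dominated_clim (fun k => z ^ k * b k)%C (fun k => Cmod z ^ k * D) (D * / (1 - Cmod z))).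
  - intros k. rewrite Cmod_mult, Cmod_pow. apply Rmult_le_compat_l; auto. apply pow_le; lra.
  - intros n. rewrite <- scal_sum. apply Rmult_le_compat_l; auto.
    apply Rmult_le_reg_l with (1 - Cmod z); [lra|]. rewrite geom_sum_le, Rinv_r by lra.
    assert (0 <= Cmod z ^ S n) by (apply pow_le; lra). lra.
Qed.

(** The first-order remainder of each monomial is quadratic in [w - z], and these
    bounds are summable on a disk of radius [s < 1]. *)
Lemma power_series_differentiable g :
  (forall z, Cmod z < 1 -> clim (psum b z) (g z)) ->
  forall z, Cmod z < 1 -> differentiable g z.
Proof.
  intros Hg z Hz. assert (P := Cmod_ge_0 z).
  assert (D0 : 0 <= D) by (eapply Rle_trans; [apply Cmod_ge_0|apply (HD O)]).
  set (s := (1 + Cmod z) / 2). assert (Hs : 0 < s < 1) by (unfold s; lra).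
  assert (Hzs : Cmod z < s) by (unfold s; lra).
  set (W := fun k => (INR k + 1) * (INR k + 2) * s ^ k).
  set (V := 2 / (1 - s) ^ 3).
  assert (HV : forall n, sum_f_R0 W n <= V) by (intros; apply quadratic_weight_sum; lra).
  assert (HV0 : 0 <= V).
  { unfold V. apply Rmult_le_pos; [lra|]. left. apply Rinv_0_lt_compat, pow_lt. lra. }
  set (c := fun k => (RtoC (INR k) * z ^ pred k * b k)%C).
  destruct (dominated_clim c (fun k => W k * (D / s)) (D / s * V)) as [l Hl].
  { intros k. unfold c. rewrite !Cmod_mult, Cmod_pow, Cmod_R, Rabs_right.
    2:{ apply Rle_ge, pos_INR. }
    assert (h := pos_INR k).
    assert (E : INR k * Cmod z ^ pred k * s <= W k).
    { destruct k as [|k]. { unfold W. simpl. lra. }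
      simpl pred. unfold W.
      assert (Cmod z ^ k * s <= s ^ S k).
      { simpl. rewrite Rmult_comm. apply Rmult_le_compat_l; [lra|]. apply pow_incr; lra. }
      assert (0 <= s ^ S k) by (apply pow_le; lra).
      apply Rle_trans with (INR (S k) * s ^ S k). { rewrite Rmult_assoc. apply Rmult_le_compat_l; auto. }
      apply Rmult_le_compat_r; auto. nra. }
    apply Rle_trans with (INR k * Cmod z ^ pred k * D).
    { apply Rmult_le_compat_l; auto. apply Rmult_le_pos; [auto|apply pow_le; auto]. }
    replace (INR k * Cmod z ^ pred k * D) with (INR k * Cmod z ^ pred k * s * (D / s)) by (field; lra).
    apply Rmult_le_compat_r; auto. apply Rmult_le_pos; auto. left; apply Rinv_0_lt_compat; lra. }
  { intros n. rewrite <- scal_sum. apply Rmult_le_compat_l; auto.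
    apply Rmult_le_pos; auto. left; apply Rinv_0_lt_compat; lra. }
  assert (B : forall w, Cmod w <= s ->
     s ^ 2 * Cmod (g w - g z - l * (w - z))%C <= D * V * Cmod (w - z)%C ^ 2).
  { intros w Hw. set (d := Cmod (w - z)%C). assert (Pd : 0 <= d) by apply Cmod_ge_0.
    assert (s2 : 0 < s ^ 2) by (apply pow_lt; lra).
    assert (Cmod (g w - g z - l * (w - z))%C <= D * V * d ^ 2 / s ^ 2).
    { apply clim_le with (N0 := O) (u := fun n => (psum b w n + (- RtoC 1) * psum b z n + (- (w - z)) * csum c n)%C).
      - intros n _. unfold psum. rewrite !csum_scal.
        rewrite !csum_plus. eapply Rle_trans; [apply Cmod_csum_le|].
        apply Rle_trans with (sum_f_R0 (fun k => W k * (D * d ^ 2 / s ^ 2)) n).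
        + apply sum_Rle. intros k _.
          replace (w ^ k * b k + - RtoC 1 * (z ^ k * b k) + - (w - z) * c k)%C
            with ((w ^ k - z ^ k - RtoC (INR k) * z ^ pred k * (w - z)) * b k)%C by (unfold c; ring).
          rewrite Cmod_mult. assert (R := power_remainder z w s k ltac:(lra) Hw). fold d in R.
          set (e := Cmod (w ^ k - z ^ k - RtoC (INR k) * z ^ pred k * (w - z))%C) in *.
          assert (e0 : 0 <= e) by apply Cmod_ge_0.
          apply Rmult_le_reg_l with (s ^ 2); auto.
          replace (s ^ 2 * (W k * (D * d ^ 2 / s ^ 2))) with (W k * d ^ 2 * D) by (field; lra).
          rewrite <- Rmult_assoc. apply Rmult_le_compat; auto.
          * apply Rmult_le_pos; lra.
          * apply Cmod_ge_0.
          * eapply Rle_trans; [exact R|]. apply Rmult_le_compat_r; [apply pow2_ge_0|].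
            unfold W. apply Rmult_le_compat_r; [apply pow_le; lra|]. assert (h := pos_INR k). nra.
        + rewrite <- scal_sum. replace (D * V * d ^ 2 / s ^ 2) with (D * d ^ 2 / s ^ 2 * V) by (field; lra).
          apply Rmult_le_compat_l; auto. apply Rmult_le_pos; [|left; now apply Rinv_0_lt_compat].
          apply Rmult_le_pos; auto. apply pow2_ge_0.
      - replace (g w - g z - l * (w - z))%C with (g w + (- RtoC 1) * g z + (- (w - z)) * l)%C by ring.
        apply clim_plus; [apply clim_plus|]; try apply clim_scal; auto. apply Hg. lra. }
    apply Rle_trans with (s ^ 2 * (D * V * d ^ 2 / s ^ 2)); [|right; field; lra].
    apply Rmult_le_compat_l; lra. }
  exists l. intros eps He.
  assert (s2 : 0 < s ^ 2) by (apply pow_lt; lra).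
  assert (DV : 0 <= D * V) by (now apply Rmult_le_pos).
  exists (Rmin (s - Cmod z) (eps * s ^ 2 / (D * V + 1))). split.
  { apply Rmin_pos; [lra|]. apply Rdiv_lt_0_compat; [nra|lra]. }
  intros w Hw.
  assert (h1 := Rlt_le_trans _ _ _ Hw (Rmin_l _ _)).
  assert (h2 := Rlt_le_trans _ _ _ Hw (Rmin_r _ _)).
  assert (Hws : Cmod w <= s) by (assert (T := Cmod_triangle_rev w z); lra).
  specialize (B w Hws). set (d := Cmod (w - z)%C) in *. assert (Pd : 0 <= d) by apply Cmod_ge_0.
  apply Rmult_le_reg_l with (s ^ 2); auto. eapply Rle_trans; [exact B|].
  assert (d * (D * V + 1) <= eps * s ^ 2).
  { apply (Rmult_lt_compat_r (D * V + 1)) in h2; [|lra].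
    replace (eps * s ^ 2 / (D * V + 1) * (D * V + 1)) with (eps * s ^ 2) in h2 by (field; lra). lra. }
  replace (s ^ 2 * (eps * d)) with (eps * s ^ 2 * d) by ring.
  replace (D * V * d ^ 2) with (D * V * d * d) by ring.
  apply Rmult_le_compat_r; auto. lra.
Qed.
End BoundedCoefficients.

(** * The norms *)

Lemma le_M_infty f z : Rbar_le (Cmod (f z)) (M_infty (Cmod z) f).
Proof.
  destruct (polar z) as [t [Ht E]].
  apply (proj1 (Lub_Rbar_correct _)). exists t. split; auto. now rewrite E at 1.
Qed.

Lemma M_infty_le f r B : 0 <= r -> (forall z, Cmod z = r -> Cmod (f z) <= B) -> Rbar_le (M_infty r f) B.
Proof.
  intros Hr HB. apply (proj2 (Lub_Rbar_correct _)). intros x [t [_ ->]]. simpl. apply HB.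
  now apply Cmod_circ.
Qed.

Lemma M_infty_ge f r x : 0 <= r -> (exists z, Cmod z = r /\ x <= Cmod (f z)) -> Rbar_le x (M_infty r f).
Proof.
  intros Hr [z [E Hx]]. apply Rbar_le_trans with (Cmod (f z)); [exact Hx|]. rewrite <- E. apply le_M_infty.
Qed.

Lemma M_infty_nonneg f r : 0 <= r -> Rbar_le 0 (M_infty r f).
Proof.
  intros Hr. apply M_infty_ge; auto. exists (circ r 0). split; [now apply Cmod_circ|apply Cmod_ge_0].
Qed.

Lemma Rbar_lub_ub (E : Rbar -> Prop) x : E x -> Rbar_le x (Rbar_lub E).
Proof. unfold Rbar_lub. destruct (Rbar_ex_lub E) as [l [H1 H2]]. apply H1. Qed.

Lemma Rbar_lub_least (E : Rbar -> Prop) b : (forall x, E x -> Rbar_le x b) -> Rbar_le (Rbar_lub E) b.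
Proof. unfold Rbar_lub. destruct (Rbar_ex_lub E) as [l [H1 H2]]. apply H2. Qed.

Lemma le_norm_Hinf f z : Cmod z < 1 -> Rbar_le (Cmod (f z)) (norm_Hinf f).
Proof.
  intros Hz. eapply Rbar_le_trans; [apply le_M_infty|]. apply Rbar_lub_ub.
  exists (Cmod z). split; auto. split; [apply Cmod_ge_0|auto].
Qed.

Lemma norm_Hinf_le f B : (forall z, Cmod z < 1 -> Cmod (f z) <= B) -> Rbar_le (norm_Hinf f) B.
Proof.
  intros HB. apply Rbar_lub_least. intros x [r [Hr ->]]. apply M_infty_le; [lra|].
  intros z Hz. apply HB. lra.
Qed.

Lemma Hinf_bounded f : Hinf f ->
  exists M, norm_Hinf f = Finite M /\ forall z, Cmod z < 1 -> Cmod (f z) <= M.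
Proof.
  intros [_ H].
  assert (P := le_norm_Hinf f (RtoC 0) ltac:(rewrite Cmod_0; lra)).
  assert (Q := le_norm_Hinf f).
  destruct (norm_Hinf f) as [M| |]; [|contradiction|contradiction].
  exists M. split; auto.
Qed.

Lemma log_weight r : 0 <= r < 1 -> ln (exp 1 / (1 - r) ^ 2) = 1 - 2 * ln (1 - r).
Proof.
  intros Hr. unfold Rdiv. assert (0 < (1 - r) ^ 2) by (apply pow_lt; lra).
  rewrite ln_mult, ln_Rinv, ln_exp by (auto using exp_pos, Rinv_0_lt_compat).
  replace ((1 - r) ^ 2) with ((1 - r) * (1 - r)) by ring. rewrite ln_mult by lra. ring.
Qed.

Lemma ln_one_minus_le_0 r : 0 <= r < 1 -> ln (1 - r) <= 0.
Proof.
  intros Hr. destruct (Req_dec r 0) as [->|n].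
  - rewrite Rminus_0_r, ln_1. lra.
  - rewrite <- ln_1. left. apply ln_increasing; lra.
Qed.

Lemma norm_Hinf_log_le g B :
  (forall z, Cmod z < 1 -> Cmod (g z) <= B * (1 - 2 * ln (1 - Cmod z))) ->
  Rbar_le (norm_Hinf_log g) B.
Proof.
  intros HB. apply Rbar_lub_least. intros x [r [Hr ->]].
  assert (Hl := ln_one_minus_le_0 r Hr). rewrite (log_weight r Hr).
  assert (U : Rbar_le (M_infty r g) (B * (1 - 2 * ln (1 - r)))).
  { apply M_infty_le; [lra|]. intros z E. rewrite <- E. apply HB. lra. }
  assert (L := M_infty_nonneg g r ltac:(lra)).
  destruct (M_infty r g) as [m| |]; [|contradiction|contradiction]. simpl in *.
  apply Rmult_le_reg_l with (1 - 2 * ln (1 - r)); [lra|].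
  rewrite <- Rmult_assoc, Rinv_r by lra. lra.
Qed.

(** The weight is [1] at the radius [0]. *)
Lemma le_norm_Hinf_log_0 g : Rbar_le (Cmod (g (RtoC 0))) (norm_Hinf_log g).
Proof.
  eapply Rbar_le_trans; [|apply Rbar_lub_ub; exists 0; split; [lra|reflexivity]].
  rewrite log_weight, Rminus_0_r, ln_1 by lra. replace (/ (1 - 2 * 0)) with 1 by field.
  assert (H := le_M_infty g (RtoC 0)). rewrite Cmod_0 in H.
  assert (U : Rbar_le (M_infty 0 g) (Cmod (g (RtoC 0)))).
  { apply M_infty_le; [lra|]. intros z Hz. apply Cmod_eq_0 in Hz. rewrite Hz. lra. }
  destruct (M_infty 0 g) as [m| |]; [|contradiction|contradiction]. simpl in *. lra.
Qed.

(** * The operator *)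

Lemma hilbert_op_exists a f M :
  expansion a f -> (forall z, Cmod z < 1 -> Cmod (f z) <= M) ->
  exists b g,
    (forall n, @is_series C_AbsRing C_NormedModule (fun k => Cdiv (a k) (RtoC (INR (n + k + 1)))) (b n)) /\
    expansion b g /\ analytic g.
Proof.
  intros Hexp HM.
  destruct (functional_choice _ (hilbert_coeff_exists a f M Hexp HM)) as [b Hb].
  assert (HD := hilbert_coeff_bounded a f M Hexp HM b Hb).
  assert (G : forall z, exists l, Cmod z < 1 -> clim (psum b z) l).
  { intros z. destruct (classic (Cmod z < 1)) as [Hz|Hz].
    - destruct (psum_converges b _ HD z Hz) as [l Hl]. now exists l.
    - exists (RtoC 0). intros; contradiction. }
  apply functional_choice in G. destruct G as [g Hg].
  exists b, g. split; [exact Hb|]. split.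
  - intros z Hz. apply is_pseries_C. now apply Hg.
  - apply analytic_iff. exact (power_series_differentiable b _ HD g Hg).
Qed.

(** The estimate holds with [1 - ln (1 - r)]; doubling the logarithm changes
    nothing at [r = 0], where the norm is decided. *)
Lemma hilbert_op_log_bound f g M :
  (forall z, Cmod z < 1 -> Cmod (f z) <= M) -> hilbert_op f g ->
  forall z, Cmod z < 1 -> Cmod (g z) <= M * (1 - 2 * ln (1 - Cmod z)).
Proof.
  intros HM [a [b [Ha [Hb [Hg _]]]]] z Hz.
  assert (P := Cmod_ge_0 z). assert (Hl := ln_one_minus_le_0 (Cmod z) (conj P Hz)).
  assert (HM0 : 0 <= M).
  { eapply Rle_trans; [apply Cmod_ge_0|apply (HM z Hz)]. }
  apply clim_le with (u := psum b z) (N0 := O).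
  - intros n _. eapply Rle_trans; [apply (hilbert_psum_le a f M Ha HM b Hb); lra|].
    apply Rmult_le_compat_l; auto.
    assert (h := hilbert_weight_le (Cmod z) n (conj P Hz)). lra.
  - apply is_pseries_C. now apply Hg.
Qed.

Lemma hilbert_op_norm_le f g M :
  (forall z, Cmod z < 1 -> Cmod (f z) <= M) -> hilbert_op f g -> Rbar_le (norm_Hinf_log g) M.
Proof. intros HM H. apply norm_Hinf_log_le. now apply hilbert_op_log_bound with (f := f). Qed.

Lemma clim_const_eq u c l : (forall n, u n = c) -> clim u l -> l = c.
Proof.
  intros E H. apply Ceq_minus, Cmod_eq_0. apply Rle_antisym; [|apply Cmod_ge_0].
  apply Rnot_lt_le. intros h. destruct (H _ h) as [N HN]. specialize (HN N (le_n _)).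
  rewrite E, Cmod_minus_sym in HN. lra.
Qed.

(** The constant function [1] is extremal: its image has the value [1] at the
    origin. *)
Lemma hilbert_norm_attained : exists f g : C -> C,
  Hinf f /\ Defs.nonzero f /\ hilbert_op f g /\ norm_Hinf f = Finite 1 /\ norm_Hinf_log g = Finite 1.
Proof.
  set (a := fun k : nat => match k with O => RtoC 1 | S _ => RtoC 0 end).
  set (f := fun _ : C => RtoC 1).
  assert (Ea : forall (w : nat -> C) n, w O = RtoC 1 -> csum (fun k => w k * a k)%C n = RtoC 1).
  { intros w n Hw. induction n as [|n IH].
    - rewrite csum_O, Hw. simpl. ring.
    - rewrite csum_S, IH. simpl. ring. }
  assert (Ha : expansion a f).
  { intros z Hz. apply is_pseries_C. intros eps He. exists O. intros n _.
    unfold psum. rewrite (Ea (fun k => z ^ k)%C) by reflexivity. unfold f.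
    replace (RtoC 1 - RtoC 1)%C with (RtoC 0) by ring. now rewrite Cmod_0. }
  assert (HM : forall z, Cmod z < 1 -> Cmod (f z) <= 1).
  { intros z _. unfold f. rewrite Cmod_1. lra. }
  assert (Nf : norm_Hinf f = Finite 1).
  { apply Rbar_le_antisym; [now apply norm_Hinf_le|].
    assert (h := le_norm_Hinf f (RtoC 0) ltac:(rewrite Cmod_0; lra)). unfold f in h at 1. now rewrite Cmod_1 in h. }
  destruct (hilbert_op_exists a f 1 Ha HM) as [b [g [Hb [Hg Ag]]]].
  assert (Hop : hilbert_op f g) by (exists a, b; auto).
  assert (b0 : b O = RtoC 1).
  { apply (clim_const_eq (csum (fun k => a k / RtoC (INR (0 + k + 1)))%C)); [|apply is_series_C, Hb].
    intros n. rewrite (csum_ext _ (fun k => / RtoC (INR (0 + k + 1)) * a k)%C).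
    - apply Ea. simpl. rewrite <- (Cinv_l (RtoC 1) C1_nz) at 2. ring.
    - intros k _. unfold Cdiv. ring. }
  assert (g0 : g (RtoC 0) = RtoC 1).
  { apply (clim_const_eq (psum b (RtoC 0))).
    - intros n. rewrite <- b0. induction n as [|n IH]; [apply psum_O|].
      rewrite psum_S, IH, Cpow_S. ring.
    - apply is_pseries_C, Hg. unfold unit_disk. rewrite Cmod_0. lra. }
  exists f, g. split; [|split; [|split; [exact Hop|split; [exact Nf|]]]].
  - split; [|rewrite Nf; exact I]. apply analytic_iff. intros z _. exists (RtoC 0).
    intros eps He. exists 1. split; [lra|]. intros w _. unfold f.
    replace (RtoC 1 - RtoC 1 - RtoC 0 * (w - z))%C with (RtoC 0) by ring. rewrite Cmod_0.
    apply Rmult_le_pos; [lra|apply Cmod_ge_0].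
  - exists (RtoC 0). split; [unfold unit_disk; rewrite Cmod_0; lra|]. exact C1_nz.
  - apply Rbar_le_antisym; [now apply (hilbert_op_norm_le f)|].
    assert (h := le_norm_Hinf_log_0 g). now rewrite g0, Cmod_1 in h.
Qed.

Lemma Hinf_expansion f : Hinf f -> exists a, expansion a f.
Proof.
  intros Hf. destruct (Hinf_bounded f Hf) as [M [_ HM]]. destruct Hf as [Af _].
  exists (taylor_coeff f). eapply taylor_expansion; [now apply analytic_iff|exact HM].
Qed.

Theorem theorem5p1 :
  (forall f : C -> C, Hinf f -> exists g : C -> C, hilbert_op f g /\ Hinf_log g) /\
  hilbert_norm = Finite 1.
Proof.
  split.
  - intros f Hf. destruct (Hinf_expansion f Hf) as [a Ha].
    destruct (Hinf_bounded f Hf) as [M [_ HM]].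
    destruct (hilbert_op_exists a f M Ha HM) as [b [g [Hb [Hg Ag]]]].
    assert (Hop : hilbert_op f g) by (exists a, b; auto).
    exists g. split; [exact Hop|]. split; [exact Ag|].
    eapply Rbar_le_lt_trans; [apply (hilbert_op_norm_le f g M HM Hop)|exact I].
  - apply Rbar_le_antisym.
    + apply Rbar_lub_least. intros x [f [g [Hf [[z [Hz Hnz]] [Hop ->]]]]].
      destruct (Hinf_bounded f Hf) as [M [EM HM]]. rewrite EM.
      assert (HM0 : 0 < M).
      { apply Rlt_le_trans with (Cmod (f z)); [now apply Cmod_gt_0|now apply HM]. }
      assert (U := hilbert_op_norm_le f g M HM Hop).
      assert (L := Rbar_le_trans 0 (Cmod (g (RtoC 0))) _ (Cmod_ge_0 (g (RtoC 0))) (le_norm_Hinf_log_0 g)).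
      destruct (norm_Hinf_log g) as [n| |]; [|contradiction|contradiction].
      simpl in *. apply Rmult_le_reg_r with M; auto. rewrite Rmult_assoc, Rinv_l; lra.
    + destruct hilbert_norm_attained as [f [g [Hf [Hnz [Hop [E1 E2]]]]]].
      apply Rbar_lub_ub. exists f, g. repeat (split; auto).
      rewrite E1, E2. simpl. f_equal. field.
Qed.
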